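(* Let $e\ge1$. There are polynomials $q_{i,j}\in\mathbb{Z}_{(2)}[x]$ such that the following upper-triangular matrix of polynomials $(P_{i,j})$, with $0\le i,j\le 2^{e+1}-3$, is a polynomial presentation matrix for $M_e$ (the reduced polynomial matrix for $M_e$), where all entries of the matrix are $0$ except those specified below: \begin{enumerate} \item[(i)] For $0\le s\le e-1$, $3\cdot2^s-2\le i<4\cdot2^s-2$ and $0\le t\le e-1-s$, $$P_{i,\,i+2^{s+1}(2^t-1)}=2^{e-1-s-t}\,p_{2^{t+1}-1}(x^{2^s}).$$ \item[(ii)] For $0\le s\le e-1$ and $2\cdot2^s-2\le i<3\cdot2^s-2$, $P_{i,i}=2^{e-s}$ and, for $2\le t\le e-s$, $$P_{i,\,i+2^{s}(2^t-1)}=2^{e-s-t}\,x^{2^s}\,p_{2^t-2}(x^{2^s}).$$ \item[(iii)] For $3\le t\le e$ and $2^t+2^{t-2}-2\le j\le 2^t+2^{t-1}-3$, there are possibly nonzero entries $P_{i,j}=2^{e-t}q_{i,j}$ for $0\le i<j-2^{t-1}$, and also, for $1\le v\le e-t$ and the same $i,j$, $$P_{i,\,j+2^t(2^v-1)}=2^{e-t-v}\,p_{2^{v+1}-1}(x^{2^{t-1}})\,q_{i,j}.$$ \end{enumerate} (Some of the entries in (ii) are among the entries in (iii); for these the two descriptions agree.)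
   Context: Let $ku_*=\mathbb{Z}_{(2)}[u]$ with $|u|=2$. $M_e$ is the graded $ku_*$-module generated by classes $[i,j]$, $i,j\ge0$, of grading $2i+2j$, with defining relations $$\sum_{\ell=0}^i\binom{2^e}{\ell+1}u^\ell[i-\ell,j]=0\quad\text{and}\quad \sum_{\ell=0}^j\binom{2^e}{\ell+1}u^\ell[i,j-\ell]=0\qquad (i,j\ge0).$$ (It is $ku_*(\Sigma^{-1}L^\infty(2^e))\otimes_{ku_*}ku_*(\Sigma^{-1}L^\infty(2^e))$.) Let $G_d$ denote the component of $M_e$ in grading $2d$, with ordered set of generators $$[0,d],\ldots,[d,0],\ u[0,d-1],\ldots,u[d-1,0],\ \ldots,\ u^d[0,0].$$ Put $p_n(x)=\frac{x^n-1}{x-1}=1+x+\cdots+x^{n-1}$ (so $p_1=1$). A polynomial $\alpha_0+\alpha_1x+\alpha_2x^2+\cdots$ corresponds to a Toeplitz matrix of any size, whose $(j+k,j)$ entry is $\alpha_k$ for $k\ge 0$ and whose entries above the diagonal are $0$. Rows and columns of polynomial matrices are numbered from $0$. A matrix of polynomials $(P_{i,j})$ with $0\le i,j\le N$ is a polynomial presentation matrix for $M_e$ if for each $d\le N$ its restriction to the first $d+1$ columns (and rows) yields a presentation of $G_d$ in the following sense: form the partitioned matrix with blocks $M_{i,j}$, $0\le i,j\le d$, where $M_{i,j}$ is the $(d+1-i)\times(d+1-j)$ Toeplitz matrix corresponding to $P_{i,j}$; the columns in block column $j$ correspond, in order, to the generators $u^j[0,d-j],\ldots,u^j[d-j,0]$.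 Then the rows of this matrix generate over $\mathbb{Z}_{(2)}$ all relations among the generators $u^j[k,d-j-k]$ ($0\le j\le d$, $0\le k\le d-j$) of $G_d$. It is called the reduced polynomial matrix because it is obtained by row reduction from the polynomial matrix of the defining relations. *)

(* Defs.v *)
From HB Require Import structures.
From mathcomp Require Import all_boot all_order all_algebra.
From mathcomp Require Import boolp.
From mathcomp Require Import monalg.
From mathcomp Require Import zify.

Set Implicit Arguments.
Unset Strict Implicit.
Unset Printing Implicit Defensive.

Import GRing.Theory Num.Theory.
Local Open Scope ring_scope.
Local Open Scope quotient_scope.

(* The ring Z_(2), as the subring of the rationals with odd denominator in    *)
(* lowest terms.                                                              *)
Definition odd_denq : {pred rat} := [pred r | odd `|denq r|%N].

Lemma odd_denqI (r : rat) (a : int) (b : nat) :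
  odd b -> r * b%:R = a%:~R -> r \in odd_denq.
Proof.
move=> ob E; rewrite inE.
have E' : numq r * b%:Z = a * denq r.
  apply: (@intr_inj rat); rewrite !intrM -E numqE -!pmulrn.
  by rewrite mulrAC.
have dv : (`|denq r| %| b)%N.
  have : (denq r %| numq r * b%:Z)%Z by rewrite E' dvdz_mull.
  by rewrite dvdzE abszM Gauss_dvdr // coprime_sym coprime_num_den.
by case/dvdnP: dv ob => c ->; rewrite oddM => /andP[].
Qed.

Lemma odd_denqE (r : rat) : r * `|denq r|%N%:R = (numq r)%:~R.
Proof. by rewrite numqE pmulrn absz_denq. Qed.

Lemma odd_denq_subring : subring_closed odd_denq.
Proof.
split=> [|x y hx hy|x y hx hy].
- by rewrite inE.
- apply: (@odd_denqI _ (numq x * `|denq y|%N - numq y * `|denq x|%N)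
                      (`|denq x| * `|denq y|)%N).
    by rewrite oddM; apply/andP.
  rewrite intrB !intrM -!odd_denqE natrM -!pmulrn.
  by rewrite mulrBl mulrA; congr (_ - _); rewrite mulrAC mulrA.
- apply: (@odd_denqI _ (numq x * numq y) (`|denq x| * `|denq y|)%N).
    by rewrite oddM; apply/andP.
  by rewrite intrM -!odd_denqE natrM mulrACA.
Qed.

HB.instance Definition _ := GRing.isSubringClosed.Build rat odd_denq
  odd_denq_subring.

Record Z2loc := MkZ2loc { Z2val : rat; Z2valP : Z2val \in odd_denq }.
HB.instance Definition _ := [isSub for Z2val].
HB.instance Definition _ := [Choice of Z2loc by <:].
HB.instance Definition _ := [SubChoice_isSubComNzRing of Z2loc by <:].

(* ku_* = Z_(2)[u], with the formal variable 'X in the role of u.             *)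
Notation ku := {poly Z2loc}.

(* The free ku_*-module on the classes [i,j]; the basis element [i,j] is      *)
(* << (i, j) >>.                                                              *)
Notation free_ku := {malg ku[(nat * nat)%type]}.

Section Module.
Variable e : nat.

Definition rel1 (i j : nat) : free_ku :=
  \sum_(l < i.+1) ('C(2 ^ e, l.+1)%:R * 'X^l) *: << ((i - l)%N, j) >>.

Definition rel2 (i j : nat) : free_ku :=
  \sum_(l < j.+1) ('C(2 ^ e, l.+1)%:R * 'X^l) *: << (i, (j - l)%N) >>.

Definition ku_comb (r : nat -> nat -> free_ku) (s : seq (ku * (nat * nat))) :=
  \sum_(x <- s) x.1 *: r x.2.1 x.2.2.

(* The ku_*-submodule generated by the defining relations.                    *)
Definition relators : {pred free_ku} := fun f =>
  `[< exists s1 s2, f = ku_comb rel1 s1 + ku_comb rel2 s2 >].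

Lemma ku_combZ a r s :
  a *: ku_comb r s = ku_comb r [seq (a * x.1, x.2) | x <- s].
Proof.
by rewrite /ku_comb big_map scaler_sumr; apply: eq_bigr => x _; rewrite scalerA.
Qed.

Lemma ku_combD r s t : ku_comb r s + ku_comb r t = ku_comb r (s ++ t).
Proof. by rewrite /ku_comb big_cat. Qed.

Lemma relatorsZ a f : f \in relators -> a *: f \in relators.
Proof.
move=> /asboolP[s1 [s2 ->]]; apply/asboolP; do 2 eexists.
by rewrite scalerDr !ku_combZ.
Qed.

Lemma relators_zmod : zmod_closed relators.
Proof.
split=> [|f g /asboolP[s1 [s2 ->]] /(relatorsZ (-1)) /asboolP[t1 [t2]]].
  by apply/asboolP; exists [::], [::]; rewrite /ku_comb !big_nil addr0.
rewrite scaleN1r => ->; apply/asboolP; do 2 eexists.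
by rewrite addrACA !ku_combD.
Qed.

HB.instance Definition _ := GRing.isZmodClosed.Build free_ku relators
  relators_zmod.

Definition M := Quotient.quot relators.
HB.instance Definition _ := GRing.Zmodule.on M.

Definition cl (f : free_ku) : M := \pi f.

Lemma clB f g : cl (f - g) = cl f - cl g.
Proof. exact: raddfB. Qed.
HB.instance Definition _ := GRing.isZmodMorphism.Build free_ku M cl clB.

Lemma clD f g : cl (f + g) = cl f + cl g.
Proof. exact: raddfD. Qed.

Lemma cl_eq f g : cl f = cl g <-> f - g \in relators.
Proof. by rewrite Quotient.idealrBE; split=> [/eqP|/eqP]. Qed.

Lemma cl_repr (x : M) : cl (repr x) = x.
Proof. exact: reprK. Qed.

Definition Mscale (a : ku) (x : M) : M := cl (a *: repr x).

Lemma clZ a f : cl (a *: f) = Mscale a (cl f).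
Proof. by apply/cl_eq; rewrite -scalerBr relatorsZ //; apply/cl_eq; rewrite cl_repr. Qed.

Lemma MscaleA a b x : Mscale a (Mscale b x) = Mscale (a * b) x.
Proof. by rewrite -[x]cl_repr -!clZ scalerA. Qed.

Lemma Mscale1 : left_id 1 Mscale.
Proof. by move=> x; rewrite -[x in LHS]cl_repr -clZ scale1r cl_repr. Qed.

Lemma MscaleDr : right_distributive Mscale +%R.
Proof.
move=> a x y; rewrite -[x]cl_repr -[y]cl_repr -clD.
by rewrite -!clZ scalerDr clD.
Qed.

Lemma MscaleDl x : {morph Mscale^~ x : a b / a + b}.
Proof. by move=> a b; rewrite -[x]cl_repr -!clZ scalerDl clD. Qed.

HB.instance Definition _ := GRing.Zmodule_isLmodule.Build ku M
  MscaleA Mscale1 MscaleDr MscaleDl.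

Lemma cl_scalable : scalable cl.
Proof. exact: clZ. Qed.
HB.instance Definition _ := GRing.isScalable.Build ku free_ku M *:%R cl
  cl_scalable.

(* The component of M_e in grading 2d (u has grading 2 and [i,j] has grading  *)
(* 2i+2j).                                                                    *)
Definition G (d : nat) (x : M) : Prop :=
  exists f : free_ku, x = cl f /\
    forall i j, exists c : Z2loc,
      f@_(i, j) = if (i + j <= d)%N then c *: 'X^(d - i - j) else 0.

(* The generator u^j[k,d-j-k] of G_d.                                         *)
Definition gen (d j k : nat) : M := ('X^j : ku) *: cl << (k, (d - j - k)%N) >>.

Lemma gen_comb d (c : nat -> nat -> Z2loc) :
  \sum_(j < d.+1) \sum_(k < d.+1 - j) (c j k)%:P *: gen d j k
  = cl (\sum_(j < d.+1) \sum_(k < d.+1 - j)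
          ((c j k)%:P * 'X^j) *: << (k : nat, (d - j - k)%N) >>).
Proof.
rewrite linear_sum; apply: eq_bigr => j _; rewrite linear_sum.
by apply: eq_bigr => k _; rewrite /= -scalerA (cl_scalable (c j k)%:P) (cl_scalable 'X^j).
Qed.

Lemma coef_gen_comb d (c : nat -> nat -> Z2loc) a b :
  (\sum_(j < d.+1) \sum_(k < d.+1 - j)
     ((c j k)%:P * 'X^j) *: << (k : nat, (d - j - k)%N) >> : free_ku)@_(a, b)
  = if (a + b <= d)%N then c (d - a - b)%N a *: 'X^(d - a - b) else 0.
Proof.
have E (j : 'I_d.+1) (k : 'I_(d.+1 - j)) :
    (((c j k)%:P * 'X^j) *: << (k : nat, (d - j - k)%N) >> : free_ku)@_(a, b)
    = if (a + b + j == d)%N && (k == a :> nat)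
      then (c j k)%:P * 'X^j else 0.
  rewrite mcoeffZ mcoeffU xpair_eqE.
  have -> : (k == a :> nat) && (d - j - k == b)%N
            = (a + b + j == d)%N && (k == a :> nat).
    have := ltn_ord k; case: (eqVneq (k : nat) a) => [->|]; last by rewrite andbF.
    by have := ltn_ord j; move=> *; apply/idP/idP => /=; lia.
  by case: ifP; rewrite ?mulr1 ?mulr0.
rewrite raddf_sum /=; under eq_bigr do rewrite raddf_sum /=.
under eq_bigr => j _ do under eq_bigr => k _ do rewrite E.
case: ifP => ab; last first.
  rewrite big1 // => j _; rewrite big1 // => k _; rewrite ifF //.
  by apply/negbTE; lia.
have hj : (d - a - b < d.+1)%N by lia.
rewrite (bigD1 (Ordinal hj)) //= [X in _ + X]big1 ?addr0; last first.
  move=> j; rewrite -val_eqE /= => nj; rewrite big1 // => k _.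
  by rewrite ifF //; apply/negbTE; lia.
have hk : (a < d.+1 - (d - a - b))%N by lia.
rewrite (bigD1 (Ordinal hk)) //= [X in _ + X]big1 ?addr0; last first.
  by move=> k; rewrite -val_eqE /= => nk; rewrite (negbTE nk) andbF.
by rewrite eqxx ifT ?mul_polyC // andbT; lia.
Qed.

Lemma G_gen d (x : M) :
  G d x <-> exists c : nat -> nat -> Z2loc,
    x = \sum_(j < d.+1) \sum_(k < d.+1 - j) (c j k)%:P *: gen d j k.
Proof.
split=> [[f [-> hf]]|[c ->]].
  have /choice[c hc] : forall ij : nat * nat, exists c : Z2loc, f@_ij =
      if (ij.1 + ij.2 <= d)%N then c *: 'X^(d - ij.1 - ij.2) else 0.
    by case=> i j; apply: hf.
  exists (fun j k => c (k, d - j - k)%N).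
  apply: etrans (esym (gen_comb d (fun j k => c (k, d - j - k)%N))).
  congr cl.
  apply/malgP => -[a b].
  rewrite hc (coef_gen_comb d (fun j k => c (k, d - j - k)%N)) /=; case: ifP => // ab.
  by congr (c (_, _) *: _); lia.
eexists; split; first exact: gen_comb.
by move=> i j; exists (c (d - i - j)%N i); rewrite coef_gen_comb.
Qed.

(* relation c: the coefficients c give a relation among the generators.       *)
(* Coefficient vectors on the ordered generators of G_d are split in blocks   *)
(* j = 0..d of sizes d+1-j; coordinate k of block j is that of u^j[k,d-j-k].  *)
Definition relation d (c : 'rV[Z2loc]_(\sum_(j < d.+1) (d.+1 - j))) : Prop :=
  \sum_(j < d.+1) \sum_(k < d.+1 - j) (submxrow c j 0 k)%:P *: gen d j k = 0.

End Module.

Definition toeplitz m n (p : {poly Z2loc}) : 'M[Z2loc]_(m, n) :=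
  \matrix_(r, c) if (c <= r)%N then p`_(r - c) else 0.

(* The presentation matrix of G_d cut out of P; d, an index of P, satisfies   *)
(* d <= N.                                                                    *)
Definition restr_mx N (P : 'M[{poly Z2loc}]_N.+1) (d : 'I_N.+1) :
    'M[Z2loc]_(\sum_(i < d.+1) (d.+1 - i), \sum_(j < d.+1) (d.+1 - j)) :=
  \mxblock_(i < d.+1, j < d.+1)
    toeplitz (d.+1 - i) (d.+1 - j)
             (P (widen_ord (ltn_ord d) i) (widen_ord (ltn_ord d) j)).

Definition poly_presentation e N (P : 'M[{poly Z2loc}]_N.+1) : Prop :=
  forall (d : 'I_N.+1) (c : 'rV[Z2loc]_(\sum_(j < d.+1) (d.+1 - j))),
    relation e c <-> exists a, c = a *m restr_mx P d.

(* p_n(x^m)                                                                   *)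
Definition pgeom (n m : nat) : {poly Z2loc} := (\sum_(k < n) 'X^k) \Po 'X^m.

(* specified e q i j v: the entry in position (i,j) is prescribed to be v.    *)
(* A position may be prescribed more than once.                               *)
Inductive specified e (q : nat -> nat -> {poly Z2loc}) :
    nat -> nat -> {poly Z2loc} -> Prop :=
| Spec_i s i t of (s <= e - 1)%N
    & (3 * 2 ^ s - 2 <= i < 4 * 2 ^ s - 2)%N & (t <= e - 1 - s)%N :
    specified e q i (i + 2 ^ s.+1 * (2 ^ t - 1))
      (2 ^+ (e - 1 - s - t) * pgeom (2 ^ t.+1 - 1) (2 ^ s))
| Spec_ii_diag s i of (s <= e - 1)%N
    & (2 * 2 ^ s - 2 <= i < 3 * 2 ^ s - 2)%N :
    specified e q i i (2 ^+ (e - s))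
| Spec_ii s i t of (s <= e - 1)%N
    & (2 * 2 ^ s - 2 <= i < 3 * 2 ^ s - 2)%N & (2 <= t <= e - s)%N :
    specified e q i (i + 2 ^ s * (2 ^ t - 1))
      (2 ^+ (e - s - t) * 'X^(2 ^ s) * pgeom (2 ^ t - 2) (2 ^ s))
| Spec_iii t i j of (3 <= t <= e)%N
    & (2 ^ t + 2 ^ (t - 2) - 2 <= j <= 2 ^ t + 2 ^ (t - 1) - 3)%N
    & (i < j - 2 ^ (t - 1))%N :
    specified e q i j (2 ^+ (e - t) * q i j)
| Spec_iii_v t i j v of (3 <= t <= e)%N
    & (2 ^ t + 2 ^ (t - 2) - 2 <= j <= 2 ^ t + 2 ^ (t - 1) - 3)%N
    & (i < j - 2 ^ (t - 1))%N & (1 <= v <= e - t)%N :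
    specified e q i (j + 2 ^ t * (2 ^ v - 1))
      (2 ^+ (e - t - v) * pgeom (2 ^ v.+1 - 1) (2 ^ (t - 1)) * q i j).

(* All positions not prescribed are zero.                                     *)
Definition reduced_form e q N (P : 'M[{poly Z2loc}]_N.+1) : Prop :=
  forall i j : 'I_N.+1,
    (forall v, specified e q i j v -> P i j = v) /\
    ((forall v, ~ specified e q i j v) -> P i j = 0).

(* Main.v *)
(* Write a and b for the operators lowering i and j in [i,j], and                *)
(* phi_e(z) = ((1 + z)^(2^e) - 1) / z.  The relations of M_e are generated by    *)
(* phi_e(u a) and phi_e(u b); as matrices these are series in the shift, and one *)
(* has to find P = P^(e) of the prescribed shape with phi_e = V P for both       *)
(* operators, such that the rows of the two matrices V span everything modulo 2. *)
(*   From P^(e) one passes to P^(e+1), whose first K_e = 2^(e+1) - 2 columns are *)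
(* twice those of P^(e), by adding columns C with V C = phi_(e+1) modulo 2.      *)
(* Modulo 2 the matrices V are triangular with respect to pivots that do not     *)
(* depend on e, so C is unique.  For all but the last 2^(e-1) nonzero new        *)
(* columns, C is obtained from the columns of the previous stages by a geometric *)
(* factor, because the right-hand side only changes by a power of x in one row;  *)
(* this is where the same q_(i,j) reappears for all v in (iii).                  *)
(*   The existence of C over the polynomials, and not only over rational         *)
(* functions, is a divisibility statement.  It follows from a functional on      *)
(* M_(e+1) that is 1/2 on u^(3 * 2^e - 3)[0,0].  That functional is obtained     *)
(* from the product of the linear forms (1+a)^i (1+b)^j - 1 over the lines (i,j) *)
(* of (Z/2^(e+1))^2 other than the axes: it vanishes on all common zeros of      *)
(* phi_(e+1)(a) and phi_(e+1)(b), hence is X phi_(e+1)(b) + Y phi_(e+1)(a), and  *)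
(* has order 3 * 2^e - 2, so that X / phi_(e+1)(a) is the functional.            *)

From HB Require Import structures.
Require Import Defs.
From mathcomp Require Import all_boot all_order all_algebra.
From mathcomp Require Import all_field boolp monalg zify ring.

Set Implicit Arguments.
Unset Strict Implicit.
Unset Printing Implicit Defensive.

Import GRing.Theory Num.Theory.
Local Open Scope ring_scope.

(** * Divisibility by powers of 2 *)

Local Notation R := {poly Z2loc}.

(** The two families of relations are the Toeplitz matrices of [th (binomial (2 ^ e)) b]: for b =
    true (first index lowered) a term u^l contributes x^l, for b = false it contributes 1.
    [relation_span] says that their rows span all relations of G_d. Hence it suffices to factor both
    as V_b P with one P, the rows of V_false and V_true together generating everything; the
    relations are then the row space of P.

    Generation is tested modulo 2, where V has the fixed staircase form [pivotal]. Row 2^s - 1 + r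
    has two pivots, in columns [alpha s r] and [beta s r], and up to a power of x the two matrices V
    act on them by (1, 1) and (1, x^(2^s)). The determinant x^(2^s) - 1 is nonzero, so V C = D
    modulo 2 has at most one polynomial solution ([pivotal_inj]); on truncated Toeplitz blocks it is
    invertible, which gives generation ([pivotal_gen]).

    The induction on e carries [halves]: V P^(e) is half of phi_(e+1) on the first K_e columns.
    [complete] supplies the columns C with V C = phi_(e+1) modulo 2. In [step] the columns of
    P^(e+1) are twice the old ones, then C above twice an identity, then zero above an identity, and
    the new columns of V are read off. [next_halves] restores the invariant through phi_(2n) = phi_n
    (2 + y t phi_n), and [reduction] concludes with phi itself.

    Since the determinant is not a unit, the existence of C ([extension]) needs more: it is read off
    from the coefficients of phi G, where the series G of [dual_series] is integral, has constant
    term an odd multiple of 2^M, and makes phi G divisible by 2^(M+1) in low degrees. That series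
    comes from [lines_ideal] and [lines_ideal_const]. *)

Lemma logn_bin_exp2 k m : (0 < m <= 2 ^ k)%N ->
  logn 2 'C(2 ^ k, m) = (k - logn 2 m)%N.
Proof.
case: m => // m /andP[_ lemk].
(* The row of order 2^k - 1 of Pascal's triangle is odd, since neighbours add up to an inner entry
   of the next row, which is even. *)
have odd_bin : forall i, (i <= (2 ^ k).-1)%N -> odd 'C((2 ^ k).-1, i).
  have ev : forall i, (0 < i < 2 ^ k)%N -> ~~ odd 'C(2 ^ k, i).
    move=> i /andP[i0 ik]; apply/negP => oC.
    have : (2 ^ k %| i * 'C(2 ^ k, i))%N.
      by case: i i0 ik oC => // i _ _ _; rewrite -mul_bin_diag dvdn_mulr.
    rewrite Gauss_dvdl; last by rewrite coprimeXl // coprime2n.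
    by move/(dvdn_leq i0); rewrite leqNgt ik.
  elim=> [|i IH] ik; first by rewrite bin0.
  have := ev i.+1; rewrite -[in 'C(2 ^ k, _)](prednK (expn_gt0 2 k)) binS oddD.
  have hk : (0 < 2 ^ k)%N by rewrite expn_gt0.
  rewrite IH; last by lia.
  by rewrite addbT negbK; apply; lia.
have := congr1 (logn 2) (mul_bin_diag (2 ^ k) m).
rewrite !lognM ?expn_gt0 ?bin_gt0 ?(leq_trans _ lemk) //; last by lia.
rewrite pfactorK //.
have -> : logn 2 'C((2 ^ k).-1, m) = 0%N.
  by rewrite lognE dvdn2 odd_bin ?andbF //; lia.
by move=> H; rewrite -(addKn (logn 2 m.+1) (logn 2 'C(_, _))) -H addn0.
Qed.

Lemma logn2_lt m k : (0 < m < 2 ^ k)%N -> (logn 2 m < k)%N.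
Proof.
move=> /andP[m0 mk]; rewrite -(ltn_exp2l _ _ (isT : 1 < 2)%N).
by apply: leq_ltn_trans mk; apply: dvdn_leq => //; apply: pfactor_dvdnn.
Qed.

Lemma logn2_eq m k : (0 < m < 2 ^ k.+1)%N -> (logn 2 m == k) = (m == 2 ^ k)%N.
Proof.
move=> /andP[m0 mk]; apply/eqP/eqP => [lm|->]; last by rewrite pfactorK.
have := pfactor_dvdnn 2 m; rewrite lm => /dvdnP[c Ec]; move: mk m0; rewrite Ec.
rewrite expnS ltn_mul2r muln_gt0 => /andP[_]; case: c {Ec} => [|[|[]]] //=.
by rewrite mul1n.
Qed.

Lemma odd_logn2 m : (0 < m)%N -> odd m = (logn 2 m == 0)%N.
Proof. by move=> m0; rewrite lognE m0 dvdn2 /=; case: (odd m). Qed.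

Lemma odd_bin_exp2_div k j m : (0 < m <= 2 ^ k)%N -> (j + logn 2 m <= k)%N ->
  (2 ^ j %| 'C(2 ^ k, m))%N
  /\ odd ('C(2 ^ k, m) %/ 2 ^ j) = (logn 2 m == k - j)%N.
Proof.
move=> hm hj; have C0 : (0 < 'C(2 ^ k, m))%N by rewrite bin_gt0; case/andP: hm.
have dv : (2 ^ j %| 'C(2 ^ k, m))%N.
  by rewrite pfactor_dvdn // logn_bin_exp2 //; lia.
split=> //; rewrite odd_logn2 ?divn_gt0 ?expn_gt0 //; last exact: dvdn_leq.
by rewrite logn_div // pfactorK // logn_bin_exp2 //; lia.
Qed.

(** Halving the coefficients of phi leaves exactly one odd one, the middle one; the pivots of the
    columns [alpha] come from it. *)
Lemma bin_half N m : (0 < m < 2 ^ N.+1)%N ->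
  exists d, 'C(2 ^ N.+1, m) = (2 * d)%N /\ odd d = (m == 2 ^ N)%N.
Proof.
move=> hm; have /andP[m0 mn] := hm; have lm := logn2_lt hm.
have [|//|dv od] := @odd_bin_exp2_div N.+1 1 m; first by rewrite m0 ltnW.
exists ('C(2 ^ N.+1, m) %/ 2)%N; rewrite mulnC divnK // (od : odd (_ %/ 2) = _).
by rewrite subn1 /= logn2_eq.
Qed.

Lemma bin_quarter N m : (0 < m < 2 ^ N.+1)%N ->
  exists d, 'C(2 ^ N.+2, m) = (2 * (2 * d))%N /\ odd d = (m == 2 ^ N)%N.
Proof.
move=> hm; have /andP[m0 mn] := hm; have lm := logn2_lt hm.
have [| |dv od] := @odd_bin_exp2_div N.+2 2 m.
- by rewrite m0 (leq_trans (ltnW mn)) // leq_exp2l.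
- by rewrite !add2n !ltnS.
exists ('C(2 ^ N.+2, m) %/ 4)%N; rewrite mulnA mulnC divnK // (od : odd (_ %/ 4) = _).
by rewrite subn2 /= logn2_eq.
Qed.

(* Reduction modulo 2: a denominator in [Z_(2)] is odd, hence equal to 1 in    *)
(* [F_2], and can be dropped.                                                  *)
Definition redz (z : Z2loc) : 'F_2 := (numq (val z))%:~R.

Lemma F2_intr0 (a : int) : (a%:~R == 0 :> 'F_2) = (2 %| a)%Z.
Proof. by rewrite -(dvdz_pcharf (pchar_Fp (isT : prime 2))). Qed.

Lemma F2_odd (b : nat) : b%:R = (odd b)%:R :> 'F_2.
Proof.
rewrite -[b in LHS]odd_double_half natrD -muln2 natrM.
by rewrite (pchar_Zp (isT : 1 < 2)%N) mulr0 addr0.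
Qed.

Lemma F2_odd1 (b : nat) : odd b -> b%:R = 1 :> 'F_2.
Proof. by rewrite F2_odd => ->. Qed.

Lemma redz_frac (z : Z2loc) (a : int) (b : nat) :
  odd b -> val z * b%:R = a%:~R -> redz z = a%:~R.
Proof.
move=> ob E; have E' : numq (val z) * b%:Z = a * denq (val z).
  apply: (@intr_inj rat); rewrite !intrM -E numqE -!pmulrn.
  by rewrite mulrAC.
have /(congr1 (fun x : int => x%:~R : 'F_2)) := E'; rewrite !intrM -pmulrn.
rewrite F2_odd ob mulr1 /redz => ->.
rewrite -[denq _]absz_denq -pmulrn F2_odd.
by have := Z2valP z; rewrite inE => ->; rewrite mulr1.
Qed.

Lemma odd_denq_val (z : Z2loc) : odd `|denq (val z)|%N.
Proof. exact: (Z2valP z). Qed.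

Lemma redz_is_zmod_morphism : zmod_morphism redz.
Proof.
move=> x y; rewrite /redz -intrB -/(redz _) -/(redz _).
rewrite (@redz_frac _ (numq (val x) * `|denq (val y)|%N
           - numq (val y) * `|denq (val x)|%N)
           (`|denq (val x)| * `|denq (val y)|)%N).
- by rewrite !intrB !intrM -!pmulrn !F2_odd1 ?odd_denq_val // !mulr1.
- by rewrite oddM !odd_denq_val.
rewrite intrB !intrM -!odd_denqE natrM -!pmulrn raddfB /=.
by rewrite mulrBl mulrA; congr (_ - _); rewrite mulrAC mulrA.
Qed.
HB.instance Definition _ := GRing.isZmodMorphism.Build Z2loc 'F_2 redz
  redz_is_zmod_morphism.

Lemma redz_is_monoid_morphism : monoid_morphism redz.
Proof.
split=> [|x y]; first by rewrite /redz rmorph1.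
rewrite (@redz_frac _ (numq (val x) * numq (val y))
           (`|denq (val x)| * `|denq (val y)|)%N).
- by rewrite intrM.
- by rewrite oddM !odd_denq_val.
by rewrite intrM -!odd_denqE natrM rmorphM mulrACA.
Qed.
HB.instance Definition _ := GRing.isMonoidMorphism.Build Z2loc 'F_2 redz
  redz_is_monoid_morphism.

Lemma redz_eq0 (z : Z2loc) : redz z = 0 -> exists w, z = w *+ 2.
Proof.
move/eqP; rewrite F2_intr0 => /dvdzP[c Ec].
have P : val z / 2 \in odd_denq.
  apply: (@odd_denqI _ c `|denq (val z)|%N); first exact: odd_denq_val.
  by rewrite mulrAC odd_denqE Ec intrM mulfK.
exists (MkZ2loc P); apply: val_inj; rewrite raddfMn /=.
by rewrite -[RHS]mulr_natr divfK.
Qed.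

Lemma redz_unit (z : Z2loc) : redz z != 0 -> exists w, w * z = 1.
Proof.
rewrite F2_intr0 dvdzE dvdn2 negbK => on.
have z0 : val z != 0 by apply: contraTneq on => ->.
have P : (val z)^-1 \in odd_denq.
  apply: (@odd_denqI _ (sgz (numq (val z)) * denq (val z)) `|numq (val z)|%N).
    exact: on.
  have -> : (`|numq (val z)|%N%:R : rat)
            = (sgz (numq (val z)) * numq (val z))%:~R.
    by rewrite pmulrn abszEsg.
  by rewrite !intrM numqE mulrCA; congr (_ * _); rewrite mulrA mulVf // mul1r.
by exists (MkZ2loc P); apply: val_inj; rewrite rmorphM rmorph1 /= mulVf.
Qed.

Lemma Z2loc_mulrn2_inj (z w : Z2loc) : z *+ 2 = w *+ 2 -> z = w.
Proof.
move/(congr1 val); rewrite !raddfMn /= => /eqP.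
by rewrite -subr_eq0 -mulrnBl mulrn_eq0 /= subr_eq0 => /eqP/val_inj.
Qed.

Local Notation rd := (map_poly redz).

Lemma rd_eq0 (p : R) : rd p = 0 -> exists w, p = w *+ 2.
Proof.
move=> rp0; have /choice[f Ef] : forall i, exists w, p`_i = w *+ 2.
  by move=> i; apply: redz_eq0; rewrite -coef_map rp0 coef0.
exists (\poly_(i < size p) f i); apply/polyP=> i.
rewrite coefMn coef_poly; case: ltnP => [_|le]; first exact: Ef.
by rewrite nth_default // mul0rn.
Qed.

Lemma rd_eq (p q : R) : rd p = rd q -> exists w, p = q + w *+ 2.
Proof.
move=> E; have [w Ew] : exists w, p - q = w *+ 2.
  by apply: rd_eq0; rewrite rmorphB /= E subrr.
by exists w; rewrite -Ew addrC subrK.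
Qed.

Lemma rd_mulrn2 (p : R) : rd (p *+ 2) = 0.
Proof. by apply/polyP=> i; rewrite coef_map coefMn raddfMn /= -mulr_natr
  (pchar_Zp (isT : 1 < 2)%N) mulr0 coef0. Qed.

Lemma R_mulrn2_inj (p q : R) : p *+ 2 = q *+ 2 -> p = q.
Proof.
move=> E; apply/polyP=> i; apply: Z2loc_mulrn2_inj.
by rewrite -!coefMn E.
Qed.

Definition dv2 (m : nat) (t : R) := exists w, t = w *+ 2 ^ m.

Lemma dv2_0 t : dv2 0 t.
Proof. by exists t. Qed.

Lemma dv2D m s t : dv2 m s -> dv2 m t -> dv2 m (s + t).
Proof. by move=> [v ->] [w ->]; exists (v + w); rewrite mulrnDl. Qed.

Lemma dv2N m t : dv2 m t -> dv2 m (- t).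
Proof. by move=> [w ->]; exists (- w); rewrite mulNrn. Qed.

Lemma dv2B m s t : dv2 m s -> dv2 m t -> dv2 m (s - t).
Proof. by move=> hs /dv2N; apply: dv2D. Qed.

Lemma dv2M m s t : dv2 m t -> dv2 m (s * t).
Proof. by move=> [w ->]; exists (s * w); rewrite mulrnAr. Qed.

Lemma dv2_sum m (I : Type) (r : seq I) (P : pred I) F :
  (forall i, P i -> dv2 m (F i)) -> dv2 m (\sum_(i <- r | P i) F i).
Proof.
move=> h; apply: (big_ind (dv2 m)) => //; last exact: dv2D.
by exists 0; rewrite mul0rn.
Qed.

Lemma dv2_double m t : dv2 m.+1 (t *+ 2) <-> dv2 m t.
Proof.
split=> [[w E]|[w ->]]; exists w; last by rewrite -mulrnA -expnSr.
by apply: R_mulrn2_inj; rewrite E -mulrnA -expnSr.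
Qed.

Lemma dv2S_rd m t : dv2 m.+1 t -> rd t = 0.
Proof. by move=> [w ->]; rewrite expnSr mulrnA rd_mulrn2. Qed.

(** * The functional on M_e *)

Definition geo (A : pzSemiRingType) (n : nat) (x : A) : A := \sum_(i < n) x ^+ i.

Lemma geo_root (A : idomainType) n (x : A) :
  x ^+ n = 1 -> x != 1 -> geo n x = 0.
Proof.
move=> xn x1; have := subrX1 x n; rewrite xn subrr => /esym/eqP.
by rewrite mulf_eq0 subr_eq0 (negbTE x1) => /eqP.
Qed.

Lemma geoX_poly (A : nzRingType) n : geo n 'X = \poly_(i < n) (1 : A).
Proof. by rewrite poly_def; apply: eq_bigr => i _; rewrite scale1r. Qed.

Lemma size_geoX (A : nzRingType) n : size (geo n 'X : {poly A}) = n.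
Proof.
rewrite geoX_poly; case: n => [|n]; first by rewrite poly_def big_ord0 size_poly0.
by rewrite size_poly_eq ?oner_eq0.
Qed.

Lemma monic_geoX (A : nzRingType) n : (geo n.+1 'X : {poly A}) \is monic.
Proof. by rewrite monicE lead_coefE size_geoX geoX_poly coef_poly ltnSn. Qed.

Lemma rmorph_geo (A B : pzSemiRingType) (f : {rmorphism A -> B}) n x :
  f (geo n x) = geo n (f x).
Proof. by rewrite rmorph_sum; apply: eq_bigr => i _; rewrite rmorphXn. Qed.

(** For n a power of 2, one factor for each cyclic subgroup of order n in (Z/n)^2 other than the
    axes: such a subgroup has a generator (i, -1) or (-1, 2j). There are 3n/2 - 2 factors, each
    vanishing at a = b = 1. *)
Definition lines (A : comPzRingType) (n : nat) (a b : A) : A :=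
  \prod_(1 <= i < n) (b - a ^+ i) * \prod_(1 <= j < n./2) (a - b ^+ (2 * j)%N).

Lemma rmorph_lines (A B : comPzRingType) (f : {rmorphism A -> B}) n a b :
  f (lines n a b) = lines n (f a) (f b).
Proof.
rewrite rmorphM !rmorph_prod; congr (_ * _);
  by apply: eq_bigr => i _; rewrite rmorphB rmorphXn.
Qed.

Lemma cyclic_pow2 k (n := (2 ^ k.+1)%N) x y :
  (0 < x < n)%N -> (0 < y < n)%N -> (logn 2 x <= logn 2 y)%N ->
  exists m, [/\ (0 < m < n)%N, y = x * m %[mod n]
               & (logn 2 x < logn 2 y)%N -> ~~ odd m].
Proof.
move=> hx hy lxy; have [x0 y0] : (0 < x)%N /\ (0 < y)%N by lia.
have n0 : (0 < n)%N by rewrite expn_gt0.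
have [a an dv] := Bezoutl x n0.
have gE : gcdn n x = (2 ^ logn 2 x)%N.
  have /(@dvdn_pfactor 2 _ _ isT)[u ule Eu] := dvdn_gcdl n x.
  rewrite Eu; congr (2 ^ _)%N; rewrite -(@pfactorK 2 u) // -Eu logn_gcd //.
  by rewrite pfactorK //; apply/minn_idPr; rewrite ltnW // logn2_lt.
have dy : (gcdn n x %| y)%N by rewrite gE pfactor_dvdn.
have Ey := divnK dy; set c := (y %/ gcdn n x)%N in Ey.
(* By Bezout a x is minus the gcd modulo n, so n - a carries x to the gcd, of which y is the
   multiple by c. *)
have E : y = x * ((n - a) * c) %[mod n].
  apply/eqP; rewrite -[in X in X == _]Ey -(eqn_modDr (a * x * c)).
  have -> : (x * ((n - a) * c) + a * x * c = n * (x * c))%N.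
    by rewrite -mulnA mulnCA -mulnDl subnK ?(ltnW an) // mulnA.
  by rewrite modnMr -/(dvdn _ _) (mulnC c) -mulnDl dvdn_mulr.
exists (((n - a) * c) %% n)%N; split.
- rewrite ltn_mod n0 andbT lt0n; apply/negP => /eqP E0.
  have : (y %% n = 0)%N by rewrite E -modnMmr E0 muln0 mod0n.
  by rewrite modn_small; lia.
- by rewrite modnMmr.
move=> lt; rewrite odd_mod; last by rewrite /n expnS oddM.
have c0 : (0 < c)%N by rewrite lt0n; apply: contraTneq y0 => c0; rewrite -Ey c0.
have ec : logn 2 c = (logn 2 y - logn 2 x)%N.
  by rewrite /c gE logn_div ?pfactorK // -gE.
by rewrite oddM negb_and (odd_logn2 c0) ec orbC subn_eq0 -ltnNge lt.
Qed.

(** Of two nonzero residues modulo a power of 2 one is a multiple of the other, by an even factor if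
    its valuation is strictly larger. This is why the second product runs over even exponents
    only. *)
Lemma lines_root (A : idomainType) k (n := (2 ^ k.+1)%N) (z : A) i l :
  n.-primitive_root z -> (0 < i < n)%N -> (0 < l < n)%N ->
  lines n (z ^+ i) (z ^+ l) = 0.
Proof.
move=> pz hi hl; apply/eqP; rewrite mulf_eq0 !prodf_seq_eq0.
case: (leqP (logn 2 i) (logn 2 l)) => [le|lt].
  have [m [hm Em _]] := cyclic_pow2 hi hl le.
  apply/orP; left; apply/hasP; exists m; first by rewrite mem_index_iota.
  by rewrite subr_eq0 -exprM (eq_prim_root_expr pz) Em eqxx.
have [m [hm Em ev]] := cyclic_pow2 hl hi (ltnW lt).
apply/orP; right; apply/hasP; exists m./2.
  by rewrite mem_index_iota; have := ev lt; rewrite /n expnS in hm *; lia.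
rewrite subr_eq0 -exprM (eq_prim_root_expr pz) Em mul2n.
by rewrite -[in X in X == _](odd_double_half m) (negbTE (ev lt)) eqxx.
Qed.

Local Notation intC := (map_poly (intr : int -> algC)).

Lemma prim_root_geo n (z : algC) i : n.-primitive_root z -> (0 < i < n)%N ->
  geo n (z ^+ i) = 0.
Proof.
move=> pz /andP[i0 ni]; apply: geo_root.
  by rewrite exprAC (prim_expr_order pz) expr1n.
by rewrite -(prim_order_dvd pz) gtnNdvd.
Qed.

Lemma poly_prim_roots0 n (z : algC) (p : {poly algC}) :
  n.-primitive_root z -> (size p < n)%N ->
  (forall i, (0 < i < n)%N -> p.[z ^+ i] = 0) -> p = 0.
Proof.
move=> pz sp hp; pose rs := [seq z ^+ i | i <- index_iota 1 n].
apply: (@roots_geq_poly_eq0 _ p rs).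
- by apply/allP=> w /mapP[i]; rewrite mem_index_iota => hi ->; apply/rootP/hp.
- rewrite map_inj_in_uniq ?iota_uniq // => i j.
  rewrite !mem_index_iota => hi hj /eqP; rewrite (eq_prim_root_expr pz).
  by rewrite !modn_small ?(andP hi).2 ?(andP hj).2 // => /eqP.
by rewrite size_map size_iota; rewrite subn1 -ltnS (ltn_predK sp).
Qed.

Lemma geo_dvd_int n (z : algC) (p : {poly int}) : n.-primitive_root z ->
  (forall i, (0 < i < n)%N -> (intC p).[z ^+ i] = 0) ->
  exists q, p = q * geo n 'X.
Proof.
move=> pz hp; have n0 := prim_order_gt0 pz.
have mg : (geo n 'X : {poly int}) \is monic by rewrite -(prednK n0) monic_geoX.
exists (Pdiv.Ring.rdivp p (geo n 'X)).
rewrite [LHS](Pdiv.RingMonic.rdivp_eq mg) [X in _ + X](_ : _ = 0) ?addr0 //.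
apply: (@map_inj_poly _ _ (intr : int -> algC)) => //; first exact: intr_inj.
rewrite rmorph0; apply: (poly_prim_roots0 pz) => [|i hi].
  rewrite size_map_inj_poly ?rmorph0 //; last exact: intr_inj.
  have := Pdiv.Ring.ltn_rmodpN0 p (monic_neq0 mg).
  by rewrite size_geoX.
have := hp i hi; rewrite [p in intC p](Pdiv.RingMonic.rdivp_eq mg) rmorphD rmorphM /=.
rewrite hornerD hornerM rmorph_geo /= map_polyX.
have -> : (geo n 'X).[z ^+ i] = geo n (z ^+ i).
  by rewrite -[LHS]/(horner_eval _ _) rmorph_geo /= /horner_eval hornerX.
by rewrite (prim_root_geo pz hi) mulr0 add0r.
Qed.

(** Divide by the monic p_n(b). For each nontrivial root of unity a, the remainder has degree below
    n - 1 in b and vanishes at n - 1 values of b, so its coefficients vanish at these a and are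
    multiples of p_n(a). *)
Lemma lines_ideal k (n := (2 ^ k.+1)%N) :
  exists X Y : {poly {poly int}},
    lines n ('X%:P) 'X = X * geo n 'X + Y * (geo n 'X)%:P.
Proof.
have [z pz] := C_prim_root_exists (expn_gt0 2 k.+1); rewrite -/n in pz.
have n0 : (0 < n)%N by rewrite expn_gt0.
set F := lines _ _ _.
have mg : (geo n 'X : {poly {poly int}}) \is monic by rewrite -(prednK n0) monic_geoX.
set r := Pdiv.Ring.rmodp F (geo n 'X).
have EF := Pdiv.RingMonic.rdivp_eq mg F; rewrite -/r in EF.
have sr : (size r < n)%N.
  by have := Pdiv.Ring.ltn_rmodpN0 F (monic_neq0 mg); rewrite size_geoX.
have /choice[q Eq] : forall j, exists q, r`_j = q * geo n 'X.
  move=> j; apply: (geo_dvd_int pz) => i hi.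
  pose ev := (horner_eval (z ^+ i) \o intC).
  have r0 : map_poly ev r = 0.
    apply: (poly_prim_roots0 pz) => [|l hl].
      exact: leq_ltn_trans (size_poly _ _) sr.
    have : (map_poly ev F).[z ^+ l] = (map_poly ev r).[z ^+ l].
      rewrite [F]EF; set Q := Pdiv.Ring.rdivp _ _.
      rewrite rmorphD rmorphM hornerD hornerM rmorph_geo /= map_polyX.
      rewrite [X in _ * X](_ : _ = geo n (z ^+ l)).
        by rewrite (prim_root_geo pz hl) mulr0 add0r.
      by rewrite -[LHS]/(horner_eval _ _) rmorph_geo /= /horner_eval hornerX.
    move=> <-.
    rewrite rmorph_lines /= map_polyC map_polyX /=.
    rewrite -[LHS]/(horner_eval _ _) rmorph_lines /= /horner_eval hornerX !hornerE.
    by rewrite /ev /= /horner_eval map_polyX hornerX lines_root.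
  by have := congr1 (fun p : {poly algC} => p`_j) r0; rewrite coef_map coef0.
exists (Pdiv.Ring.rdivp F (geo n 'X)), (\poly_(j < size r) q j).
rewrite {1}EF; congr (_ + _); apply/polyP=> j; rewrite coefMC coef_poly.
by case: ltnP => [_|le]; [exact: Eq | rewrite nth_default // mul0r].
Qed.

Lemma geo_double (A : comNzRingType) m (x : A) :
  geo (m + m) x = geo m x * (1 + x ^+ m).
Proof.
rewrite /geo big_split_ord /= mulrDr mulr1; congr (_ + _).
by rewrite mulr_suml; apply: eq_bigr => i _; rewrite exprD mulrC.
Qed.

Lemma geo_X_eval (A : comNzRingType) n (x : A) : (geo n 'X).[x] = geo n x.
Proof. by rewrite -[LHS]/(horner_eval _ _) rmorph_geo /= /horner_eval hornerX. Qed.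

Lemma geo1 (A : pzSemiRingType) n : geo n (1 : A) = n%:R.
Proof.
by rewrite /geo (eq_bigr _ (fun i _ => expr1n _ _)) sumr_const card_ord.
Qed.

Lemma prod_1_sub_prim_root (A : fieldType) n (w : A) : n.-primitive_root w ->
  \prod_(1 <= i < n) (1 - w ^+ i) = n%:R.
Proof.
move=> pw; have n0 := prim_order_gt0 pw.
have := factor_Xn_sub_1 pw; rewrite big_ltn // expr0 subrX1 => E.
have /mulfI/(_ _ _ E) {}E : ('X - 1%:P : {poly A}) != 0 by rewrite polyXsubC_eq0.
have := congr1 (horner_eval 1) E; rewrite /horner_eval -/(geo n 'X) geo_X_eval geo1.
by rewrite -[LHS]/(horner_eval _ _) rmorph_prod => <-;
  apply: eq_bigr => i _; rewrite /= /horner_eval !hornerE.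
Qed.

Lemma prim_root_pow_odd k (n := (2 ^ k.+1)%N) (A : fieldType) (z : A) i :
  n.-primitive_root z -> odd i -> n.-primitive_root (z ^+ i).
Proof.
move=> pz oi; have := exp_prim_root pz i.
suff -> : (n %/ gcdn i n = n)%N by [].
suff /eqP -> : coprime i n by rewrite divn1.
by rewrite /n coprimeXr // coprimen2.
Qed.

Lemma prim_root_half k (n := (2 ^ k.+1)%N) (A : fieldType) (w : A) :
  n.-primitive_root w -> w ^+ (2 ^ k) = -1.
Proof.
move=> pw; have : (w ^+ (2 ^ k) - 1) * (w ^+ (2 ^ k) + 1) = 0.
  rewrite -subr_sqr expr1n -exprM mulnC -expnS.
  by rewrite (prim_expr_order pw) subrr.
move/eqP; rewrite mulf_eq0 subr_eq0 addr_eq0 -(prim_order_dvd pw).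
rewrite gtnNdvd ?expn_gt0 //= => [/eqP //|].
by rewrite /n ltn_exp2l.
Qed.

(* Setting b = 1 in [lines = X p_n(b) + Y p_n(a)] gives n X(a,1) modulo        *)
(* p_n(a), which is evaluated at the roots of unity.                           *)
Lemma lines_ideal_const k (n := (2 ^ k.+1)%N) (X Y : {poly {poly int}}) :
  lines n ('X%:P) 'X = X * geo n 'X + Y * (geo n 'X)%:P ->
  exists u : int, X.[1].[1] = u * (2 ^ k)%:R /\ u%:~R = 1 :> 'F_2.
Proof.
move=> EF; have n0 : (0 < n)%N by rewrite expn_gt0.
have nE : n = (2 ^ k + 2 ^ k)%N by rewrite /n expnS mul2n addnn.
have k0 : (0 < 2 ^ k)%N by rewrite expn_gt0.
have [z pz] := C_prim_root_exists n0.
have F1 : (\prod_(1 <= i < n) (1 - 'X ^+ i) * ('X - 1) ^+ (2 ^ k).-1 : {poly int})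
          = X.[1] * n%:R + Y.[1] * geo n 'X.
  have := congr1 (horner_eval 1) EF; rewrite rmorph_lines rmorphD !rmorphM /=.
  rewrite /horner_eval !hornerE geo_X_eval geo1 => <-.
  rewrite /lines; congr (_ * _); rewrite nE addnn doubleK.
  rewrite (eq_bigr (fun _ => 'X - 1)) => [|j _]; last by rewrite expr1n.
  by rewrite prodr_const_nat subn1.
(* At a primitive root w one finds X(w,1) = (w - 1)^(2^k - 1), hence h(w) = -2 X(w,1); at the other
   nontrivial roots both vanish. So 2 X(a,1) + h is a multiple Q p_n. Modulo 2, h itself is p_n, so
   Q is 1 there. *)
pose h : {poly int} := geo (2 ^ k) 'X * ('X - 1) ^+ (2 ^ k).
have hz i : (0 < i < n)%N -> (intC (X.[1] *+ 2 + h)).[z ^+ i] = 0.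
  move=> hi; set w := z ^+ i.
  pose f : {rmorphism {poly int} -> algC} := horner_eval w \o intC.
  have fX : f 'X = w by rewrite /f /= map_polyX /horner_eval hornerX.
  have fg : f (geo n 'X) = 0 by rewrite rmorph_geo fX prim_root_geo.
  rewrite -[LHS]/(f (X.[1] *+ 2 + h)).
  apply: (@mulIf _ n%:R); first by rewrite pnatr_eq0 -lt0n.
  rewrite mul0r.
  have -> : f (X.[1] *+ 2 + h) * n%:R
     = f ((X.[1] * n%:R + Y.[1] * geo n 'X) *+ 2 + h * n%:R).
    rewrite !(rmorphD, rmorphMn, rmorphM, rmorph_nat) fg; ring.
  rewrite -F1 rmorphD rmorphMn !rmorphM rmorph_nat rmorph_geo !rmorphXn rmorphB.
  rewrite fX rmorph1 rmorph_prod.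
  rewrite (eq_bigr (fun i => 1 - w ^+ i)) => [|j _]; last first.
    by rewrite rmorphB rmorph1 rmorphXn fX.
  have [oi|ei] := boolP (odd i).
    have pw : n.-primitive_root w by apply: prim_root_pow_odd.
    rewrite (prod_1_sub_prim_root pw) -[in X in _ + _ * X * _](prednK k0) exprS.
    rewrite mulrA -(mulrC (w - 1)) -subrX1 (prim_root_half pw); ring.
  have wk : w ^+ (2 ^ k) = 1.
    rewrite /w -exprM -(odd_double_half i) (negbTE ei) add0n -muln2 -mulnA.
    by rewrite -expnS -/n mulnC exprM (prim_expr_order pz) expr1n.
  have w1 : w != 1.
    by rewrite /w -(prim_order_dvd pz); case/andP: hi => i0 hn; rewrite gtnNdvd.
  rewrite (geo_root wk w1) !mul0r addr0.
  rewrite (bigD1_seq (2 ^ k)%N) ?iota_uniq //=.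
    by rewrite wk subrr !mul0r mul0rn.
  by rewrite mem_index_iota k0 nE; lia.
have [Q EQ] := geo_dvd_int pz hz.
exists Q.[1]; split.
  have := congr1 (horner_eval 1) EQ; rewrite /horner_eval !hornerE /= !geo_X_eval !geo1.
  rewrite subrr expr0n eqn0Ngt k0 /= mulr0 addr0 [in n%:R]nE natrD mulrDr.
  by move: X.[1].[1] (Q.[1] * _) => x y; lia.
have rQ : map_poly (intr : int -> 'F_2) Q = 1.
  have g0 : (geo n 'X : {poly 'F_2}) != 0.
    by rewrite -(prednK n0) monic_neq0 ?monic_geoX.
  apply: (mulIf g0); rewrite mul1r.
  have := congr1 (map_poly (intr : int -> 'F_2)) EQ.
  rewrite rmorphM /= rmorph_geo /= map_polyX => <-.
  rewrite rmorphD rmorphMn rmorphM /= rmorph_geo rmorphXn rmorphB /= map_polyX.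
  rewrite rmorph1 nE geo_double -mulr_natr -polyC_natr.
  rewrite (pchar_Zp (isT : 1 < 2)%N) mulr0 add0r.
  have p2 : 2%N \in [pchar {poly 'F_2}] by rewrite pchar_poly pchar_Fp.
  rewrite addrC (oppr_pchar2 p2) exprDn_pchar; last by rewrite pnatX pnatE ?p2.
  by rewrite expr1n.
have := horner_map (intr : int -> 'F_2) Q 1.
by rewrite rQ hornerE => <-.
Qed.

(** * Power series and the substitution a = 1 + x t, b = 1 + t *)

Lemma geo_1D (A : comNzRingType) n (c : A) :
  geo n (1 + c) = \sum_(l < n) c ^+ l *+ 'C(n, l.+1).
Proof.
elim: n => [|n IH]; first by rewrite /geo !big_ord0.
rewrite /geo big_ord_recr /= -/(geo n (1 + c)) IH exprDn.
under [X in _ + X]eq_bigr do rewrite expr1n mul1r.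
under [RHS]eq_bigr do rewrite binS mulrnDr.
rewrite big_split /= [X in _ = X + _]big_ord_recr /= bin_small //. by rewrite addr0.
Qed.

(* With t of degree 1, a power series over [Z_(2)[x]] that is homogeneous in   *)
(* (x t, t) has its coefficient of t^k of degree at most k in x.               *)
Definition bnd (p : {poly R}) := forall k, (size (p`_k)%R <= k.+1)%N.

Lemma bnd0 : bnd 0.
Proof. by move=> k; rewrite coef0 size_poly0. Qed.

Lemma bndD p q : bnd p -> bnd q -> bnd (p + q).
Proof.
move=> hp hq k; rewrite coefD (leq_trans (size_polyD _ _)) // geq_max.
by rewrite hp hq.
Qed.

Lemma bndM p q : bnd p -> bnd q -> bnd (p * q).
Proof.
move=> hp hq k; rewrite coefM; apply: (big_ind (fun s : R => size s <= k.+1)%N).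
- by rewrite size_poly0.
- by move=> s t hs ht; rewrite (leq_trans (size_polyD _ _)) // geq_max hs ht.
move=> i _; apply: leq_trans (size_polyMleq _ _) _.
by have := hp i; have := hq (k - i)%N; have := ltn_ord i; lia.
Qed.

Lemma bndC (c : Z2loc) : bnd c%:P%:P.
Proof.
move=> k; rewrite coefC; case: eqP => _; last by rewrite size_poly0.
by rewrite (leq_trans (size_polyC_leq1 _)).
Qed.

Lemma bnd_nat n : bnd n%:R.
Proof. by rewrite -!polyC_natr; apply: bndC. Qed.

Lemma bndN p : bnd p -> bnd (- p).
Proof. by move=> hp k; rewrite coefN size_polyN. Qed.

Lemma bnd_sum (I : Type) (r : seq I) (P : pred I) F :
  (forall i, P i -> bnd (F i)) -> bnd (\sum_(i <- r | P i) F i).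
Proof. by move=> h; apply: (big_ind bnd) => //; [exact: bnd0 | exact: bndD]. Qed.

Lemma bndX p n : bnd p -> bnd (p ^+ n).
Proof.
move=> hp; elim: n => [|n IH]; first exact: (bnd_nat 1).
by rewrite exprS; apply: bndM.
Qed.

Lemma bnd_int (c : int) : bnd c%:~R.
Proof.
by case: c => n; rewrite ?NegzE ?mulrNz -?pmulrn; [|apply: bndN]; apply: bnd_nat.
Qed.

Lemma bnd_T (y : R) : (size y <= 2)%N -> bnd (y *: 'X).
Proof.
move=> sy k; rewrite coefZ coefX; case: eqP => [->|_]; first by rewrite mulr1.
by rewrite mulr0 size_poly0.
Qed.

Lemma bnd_horner (p : {poly {poly R}}) a :
  (forall i, bnd p`_i) -> bnd a -> bnd p.[a].
Proof.
by move=> hp ha; rewrite horner_coef; apply: bnd_sum => i _; apply: bndM => //;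
  apply: bndX.
Qed.

Definition phi n (y : R) : {poly R} := \poly_(l < n) (y ^+ l *+ 'C(n, l.+1)).

Lemma phi_geo n y : phi n y = geo n (1 + y *: 'X).
Proof.
rewrite geo_1D /phi poly_def; apply: eq_bigr => l _.
by rewrite exprZn scalerMnl.
Qed.

Definition xvar (b : bool) : R := if b then 'X else 1.

Lemma size_xvar b : (size (xvar b) <= 2)%N.
Proof. by case: b; rewrite /xvar ?size_polyX ?size_poly1. Qed.

Lemma horner0_divX (A : nzRingType) (p : {poly A}) :
  p.[0] = 0 -> exists w, p = w * 'X.
Proof.
by move=> /eqP/factor_theorem[w ->]; exists w; rewrite subr0.
Qed.

Lemma lines_1D k (n := (2 ^ k.+1)%N) (x : R) : exists W,
  lines n (1 + x *: 'X) (1 + 'X) = W * 'X ^+ (3 * 2 ^ k - 2)%N.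
Proof.
have k0 : (0 < 2 ^ k)%N by rewrite expn_gt0.
have nE : n = (2 ^ k + 2 ^ k)%N by rewrite /n expnS mul2n addnn.
have /choice[f Ef] : forall i, exists w : {poly R},
    (1 + 'X) - (1 + x *: 'X) ^+ i = w * 'X.
  by move=> i; apply: horner0_divX; rewrite !hornerE /= ?mulr0 ?addr0 expr1n subrr.
have /choice[g Eg] : forall j, exists w : {poly R},
    (1 + x *: 'X) - (1 + 'X) ^+ (2 * j)%N = w * 'X.
  by move=> i; apply: horner0_divX; rewrite !hornerE /= ?mulr0 ?addr0 expr1n subrr.
exists (\prod_(1 <= i < n) f i * \prod_(1 <= j < n./2) g j).
rewrite /lines (eq_bigr _ (fun i _ => Ef i)) (eq_bigr _ (fun i _ => Eg i)).
rewrite !big_split /= !prodr_const_nat mulrACA -exprD; congr (_ * 'X ^+ _).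
by rewrite nE addnn doubleK; lia.
Qed.

Section Substitution.

Variable x : R.

Let a : {poly R} := 1 + x *: 'X.
Let b : {poly R} := 1 + 'X.
Let ev1 : {rmorphism {poly int} -> {poly R}} :=
  horner_eval a \o map_poly (intr : int -> {poly R}).
Definition subst_1D : {rmorphism {poly {poly int}} -> {poly R}} :=
  horner_eval b \o map_poly ev1.

Lemma subst_1D_C p : subst_1D p%:P = (map_poly intr p).[a].
Proof. by rewrite /subst_1D /= map_polyC /horner_eval hornerC. Qed.

Lemma subst_1D_CX : subst_1D ('X%:P) = a.
Proof. by rewrite subst_1D_C map_polyX hornerX. Qed.

Lemma subst_1D_X : subst_1D 'X = b.
Proof. by rewrite /subst_1D /= map_polyX /horner_eval hornerX. Qed.

Lemma bnd_subst_1D F : (size x <= 2)%N -> bnd (subst_1D F).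
Proof.
move=> sx; have ba : bnd a by apply: bndD (bnd_nat 1) (bnd_T sx).
have bb : bnd b.
  by apply: bndD (bnd_nat 1) _; rewrite -[X in bnd X]scale1r; apply: bnd_T;
    rewrite size_poly1.
apply: bnd_horner => // i; rewrite coef_map; apply: bnd_horner => // j.
by rewrite coef_map; apply: bnd_int.
Qed.

(** Setting t = 0 means a = b = 1, so the constant term is the number computed in
    [lines_ideal_const]. *)
Lemma subst_1D_coef0 F : (subst_1D F)`_0 = F.[1].[1]%:~R.
Proof.
have E0 (A : comNzRingType) (p : {poly {poly A}}) (c : {poly A}) :
    p.[c]`_0 = (map_poly (horner_eval 0) p).[c`_0].
  by rewrite -!horner_coef0 -[LHS]/(horner_eval 0 _) -horner_map.
have a0 : a`_0 = 1 by rewrite coefD coefZ coefX coef1 mulr0 addr0.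
have b0 : b`_0 = 1 by rewrite coefD coefX coef1 addr0.
rewrite /subst_1D /= /horner_eval E0 b0 -map_poly_comp.
rewrite (@eq_map_poly _ _ _ (intr \o horner_eval 1)) => [|p /=].
  pose h : {rmorphism {poly int} -> R} := intr \o horner_eval 1.
  by have := horner_map h F 1; rewrite rmorph1.
rewrite /horner_eval horner_coef0 E0 a0 -map_poly_comp.
rewrite (@eq_map_poly _ _ _ (intr : int -> R)) => [|c /=].
  by have := horner_map (intr : int -> R) p 1; rewrite rmorph1.
exact: (rmorph_int (horner_eval (0 : R))).
Qed.

End Substitution.

(* The series g = G / 2^(M+1), whose constant term is half a unit and for      *)
(* which phi(a) g and phi(b) g are integral up to degree 3 * 2^k - 3: writing  *)
(* [lines = X phi(b) + Y phi(a)], which has order 3 * 2^k - 2, it is           *)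
(* X / phi(a).                                                                 *)
Lemma dual_series k (n := (2 ^ k.+1)%N) :
  exists (G : {poly R}) (M : nat) (u : R),
  [/\ bnd G, G`_0 = u *+ 2 ^ M, rd u = 1 &
   forall c j, (j < 3 * 2 ^ k - 2)%N -> dv2 M.+1 (phi n (xvar c) * G)`_j].
Proof.
have [X [Y EF]] := lines_ideal k; rewrite -/n in EF.
have [u [Eu ru]] := lines_ideal_const EF.
set L := (3 * 2 ^ k - 2)%N.
have k0 : (0 < 2 ^ k)%N by rewrite expn_gt0.
have L0 : (0 < L)%N by rewrite /L; lia.
have EL : ((k.+1 * L)%N = ((k.+1 * L).-1).+1)%N by rewrite prednK // muln_gt0.
pose x := xvar true; pose X1 := subst_1D x X; pose Y1 := subst_1D x Y.
have [W EW] := lines_1D k x.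
have E1 : W * 'X^L = X1 * phi n 1 + Y1 * phi n x.
  rewrite -EW !phi_geo scale1r.
  have := congr1 (subst_1D x) EF; rewrite (rmorph_geo polyC) rmorph_lines.
  by rewrite rmorphD !rmorphM !rmorph_geo subst_1D_CX subst_1D_X.
have [psi Ep] : exists psi, phi n x = n%:R + psi * 'X.
  have [|psi Ep] := @horner0_divX _ (phi n x - n%:R).
    rewrite -polyC_natr !hornerE horner_coef0 coef_poly expn_gt0 /=.
    by rewrite expr0 bin1 subrr.
  by exists psi; rewrite -Ep addrC subrK.
(* By the geometric series this is n^L times the inverse of phi(a) modulo t^L. The power 2^(M+1) is
   n^L. *)
pose kap : {poly R} := \sum_(i < L) n%:R ^+ (L.-1 - i) * (- (psi * 'X)) ^+ i.
have Ek : phi n x * kap = (n ^ L)%:R - (- psi) ^+ L * 'X^L.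
  by rewrite natrX Ep -[psi * 'X]opprK -subrXX -mulNr exprMn.
have bpsi : bnd (psi * 'X).
  have -> : psi * 'X = phi n x - n%:R by rewrite Ep addrC addKr.
  apply: bndD; last by apply/bndN/bnd_nat.
  rewrite phi_geo; apply: bnd_sum => i _; apply: bndX; apply: bndD (bnd_nat 1) _.
  by apply: bnd_T; apply: size_xvar.
have nL : (n ^ L = 2 ^ (k.+1 * L).-1.+1)%N by rewrite -EL expnM.
have cX (p : {poly R}) j : (j < L)%N -> (p * 'X^L)`_j = 0.
  by move=> jL; rewrite coefMXn jL.
exists (X1 * kap), (k.+1 * L).-1, u%:~R; split.
- apply: bndM; first by apply: bnd_subst_1D; apply: size_xvar.
  apply: bnd_sum => i _; apply: bndM; apply: bndX; first exact: bnd_nat.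
  exact: bndN.
- have k0L : kap`_0 = (n ^ L.-1)%:R.
    have h0 : horner_eval 0 (- (psi * 'X)) = 0 :> R.
      by rewrite /horner_eval !hornerE ?mulr0 ?oppr0.
    rewrite -horner_coef0 -[LHS]/(horner_eval 0 _) rmorph_sum.
    rewrite (bigD1 (Ordinal L0)) //= big1 ?addr0 => [|i]; last first.
      by rewrite -val_eqE /= rmorphM !rmorphXn /= h0 expr0n => /negbTE ->; rewrite mulr0.
    by rewrite rmorphM !rmorphXn rmorph_nat expr0 mulr1 subn0.
  rewrite coefM big_ord1 k0L subst_1D_coef0 Eu intrM rmorph_nat -mulrA -natrM.
  rewrite mulr_natr; congr (_ *+ _); rewrite -expnM -expnD; congr (2 ^ _)%N.
  by rewrite -[L in RHS](prednK L0); lia.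
- by rewrite rmorph_int -[LHS](rmorph_int polyC) ru.
case=> j jL.
  rewrite mulrCA Ek mulrBr [in X in X`_j]mulrA coefB cX // subr0 nL.
  by rewrite mulr_natr coefMn; exists (X1`_j).
(* Modulo t^L, X phi(b) is -Y phi(a), so phi(b) G is -Y times n^L. *)
rewrite mulrA [phi n _ * _]mulrC -[X1 * _](addrK (Y1 * phi n x)) -E1.
rewrite mulrBl -mulrA (mulrC 'X^L) mulrA coefB cX // sub0r.
rewrite -mulrA Ek mulrBr [in X in X`_j]mulrA coefB cX // subr0 nL mulr_natr coefMn.
by apply: dv2N; exists (Y1`_j).
Qed.

(** * Pivots *)

(** The stage t at which column j is added, 2^(t+1) - 2 <= j < 2^(t+2) - 2; [rho j] is its position
    among the columns of that stage. *)
Definition lev (j : nat) := (trunc_log 2 j.+2).-1.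
Definition rho (j : nat) := (j.+2 - 2 ^ (lev j).+1)%N.

Lemma levP j : (j.+2 = 2 ^ (lev j).+1 + rho j)%N /\ (rho j < 2 ^ (lev j).+1)%N.
Proof.
have /andP[le lt] :=  (@trunc_log_bounds 2 j.+2 isT isT).
have l0 : (0 < trunc_log 2 j.+2)%N by rewrite trunc_log_gt0.
rewrite /rho /lev prednK //; split; first by rewrite subnKC.
by rewrite ltn_subLR // addnn -mul2n -expnS.
Qed.

Lemma lev_rho t r : (r < 2 ^ t.+1)%N ->
  lev (2 ^ t.+1 - 2 + r) = t /\ rho (2 ^ t.+1 - 2 + r) = r.
Proof.
move=> hr; have t2 : (1 < 2 ^ t.+1)%N by rewrite -[1%N]/(2 ^ 0)%N ltn_exp2l.
have E : (2 ^ t.+1 - 2 + r).+2 = (2 ^ t.+1 + r)%N by lia.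
have lE : lev (2 ^ t.+1 - 2 + r) = t.
  by rewrite /lev E (@trunc_log_eq 2 t.+1) // leq_addr /= [(2 ^ t.+2)%N]expnS; lia.
by rewrite /rho lE E addKn.
Qed.

(* Modulo 2, row k of the transition matrices [V] below has its pivots in the  *)
(* two columns j with [piv j = k].                                             *)
Definition isbeta j := (2 ^ lev j <= rho j)%N.
Definition piv j := if isbeta j then (rho j).-1 else (2 ^ lev j - 1 + rho j)%N.
Definition alpha s r := (2 ^ s.+1 - 2 + r)%N.
Definition beta s r := (3 * 2 ^ s - 2 + r)%N.

Lemma piv_alpha s r : (r < 2 ^ s)%N ->
  piv (alpha s r) = (2 ^ s - 1 + r)%N /\ isbeta (alpha s r) = false.
Proof.
move=> hr; have [|l1 l2] := @lev_rho s r; first by rewrite expnS; lia.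
by rewrite /piv /isbeta /alpha l1 l2 leqNgt hr.
Qed.

Lemma piv_beta s r : (r < 2 ^ s)%N ->
  piv (beta s r) = (2 ^ s - 1 + r)%N /\ isbeta (beta s r).
Proof.
move=> hr; have [|l1 l2] := @lev_rho s (2 ^ s + r); first by rewrite expnS; lia.
have -> : beta s r = (2 ^ s.+1 - 2 + (2 ^ s + r))%N.
  by rewrite /beta expnS; have : (0 < 2 ^ s)%N by [rewrite expn_gt0]; lia.
have s0 : (0 < 2 ^ s)%N by rewrite expn_gt0.
rewrite /piv /isbeta l1 l2 leq_addr; split=> //; lia.
Qed.

Lemma pivP j : exists s r, [/\ (r < 2 ^ s)%N, piv j = (2 ^ s - 1 + r)%N &
  j = alpha s r \/ j = beta s r].
Proof.
have [Ej hr] := levP j; have s0 : (0 < 2 ^ lev j)%N by rewrite expn_gt0.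
exists (lev j); rewrite /piv /isbeta /alpha /beta; case: leqP => h.
  exists (rho j - 2 ^ lev j)%N; rewrite expnS in Ej hr *.
  by split; [lia | lia | right; lia].
by exists (rho j); split=> //; left; rewrite expnS in Ej *; lia.
Qed.

Lemma pow2_ltP s e : (s < e)%N -> (2 ^ s.+1 <= 2 ^ e)%N.
Proof. by move=> h; rewrite leq_exp2l. Qed.

Definition K e := (2 ^ e.+1 - 2)%N.

Lemma alpha_beta_K e s r : (r < 2 ^ s)%N -> (s < e)%N ->
  (alpha s r < beta s r)%N /\ (beta s r < K e)%N.
Proof.
move=> hr /pow2_ltP; have : (0 < 2 ^ s)%N by rewrite expn_gt0.
by rewrite /alpha /beta /K !expnS; lia.
Qed.

Lemma lt_of_pow s e r : (2 ^ s - 1 + r < 2 ^ e - 1)%N -> (s < e)%N.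
Proof.
move=> h; rewrite -(ltn_exp2l _ _ (isT : 1 < 2)%N); lia.
Qed.

Lemma piv_K e j : (j < K e)%N -> (piv j < 2 ^ e - 1)%N.
Proof.
move=> jK; have [s [r [hr Ep Ej]]] := pivP j; rewrite Ep.
have s0 : (0 < 2 ^ s)%N by rewrite expn_gt0.
have se : (s < e)%N.
  rewrite ltnNge; apply/negP => es; have : (2 ^ e <= 2 ^ s)%N by rewrite leq_exp2l.
  by move: jK; rewrite /K expnS; case: Ej => ->; rewrite /alpha /beta ?expnS; lia.
have := pow2_ltP se; rewrite expnS; lia.
Qed.

Lemma row_pivot e k : (k < 2 ^ e - 1)%N ->
  exists s r, [/\ (s < e)%N, (r < 2 ^ s)%N & k = (2 ^ s - 1 + r)%N].
Proof.
move=> hk; have /andP[lo hi] :=  (@trunc_log_bounds 2 k.+1 isT isT).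
set s := trunc_log 2 k.+1 in lo hi; exists s, (k.+1 - 2 ^ s)%N.
have s0 : (0 < 2 ^ s)%N by rewrite expn_gt0.
have E : k = (2 ^ s - 1 + (k.+1 - 2 ^ s))%N by lia.
split=> //; last by rewrite expnS in hi; lia.
by apply: (@lt_of_pow _ _ (k.+1 - 2 ^ s)); rewrite -E.
Qed.

Lemma piv_eq j s r : (r < 2 ^ s)%N -> piv j = (2 ^ s - 1 + r)%N ->
  j = alpha s r \/ j = beta s r.
Proof.
have [s' [r' [hr' -> Ej]]] := pivP j => hr E.
suff [Es Er] : s' = s /\ r' = r by move: Ej; rewrite Es Er.
have : s' = s.
  have a0 : (0 < 2 ^ s)%N by rewrite expn_gt0.
  have a1 : (0 < 2 ^ s')%N by rewrite expn_gt0.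
  case: (ltngtP s' s) => // /pow2_ltP; rewrite expnS; lia.
by move=> Es; split=> //; rewrite Es in E; lia.
Qed.

(** The staircase form modulo 2. The last clause, that a column [beta] has only its pivot, allows a
    right-hand side to be changed in a single row. *)
Definition pivotal e (V : bool -> nat -> nat -> R) : Prop :=
  [/\ forall b k j, (j < K e)%N -> (piv j < k)%N -> rd (V b k j) = 0,
      forall b j, (j < K e)%N ->
        rd (V b (piv j) j) = rd (xvar b) ^+ (j - piv j) &
      forall b k j, (j < K e)%N -> isbeta j -> k != piv j -> rd (V b k j) = 0].

Lemma sum_ord_two (A : nmodType) n (F : nat -> A) a b :
  (a < n)%N -> (b < n)%N -> a != b ->
  (forall j, (j < n)%N -> j != a -> j != b -> F j = 0) ->
  \sum_(j < n) F j = F a + F b.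
Proof.
move=> an bn ab h; rewrite (bigD1 (Ordinal an)) //= (bigD1 (Ordinal bn)) /=.
  rewrite big1 ?addr0 // => j /andP[ja jb].
  by apply: h; [exact: ltn_ord | move: ja | move: jb]; rewrite -val_eqE.
by rewrite -val_eqE eq_sym.
Qed.

(** Only the two columns with this pivot contribute: the entries of columns with a smaller pivot are
    even here, and t is even at those with a larger one. *)
Lemma pivot_row e V (t : nat -> R) b s r :
  pivotal e V -> (s < e)%N -> (r < 2 ^ s)%N ->
  (forall j, (j < K e)%N -> (2 ^ s - 1 + r < piv j)%N -> rd (t j) = 0) ->
  rd (\sum_(j < K e) V b (2 ^ s - 1 + r)%N j * t j)
  = rd (xvar b) ^+ (2 ^ s - 1)%N * rd (t (alpha s r))
    + rd (xvar b) ^+ (2 ^ s.+1 - 1)%N * rd (t (beta s r)).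
Proof.
move=> [S1 S2 _] se hr ht; have [ab bK] := alpha_beta_K hr se.
have aK := ltn_trans ab bK.
have [pa _] := piv_alpha hr; have [pb _] := piv_beta hr.
have s0 : (0 < 2 ^ s)%N by rewrite expn_gt0.
rewrite rmorph_sum (sum_ord_two (F := fun j => rd (V b (2 ^ s - 1 + r)%N j * t j)) aK bK).
- rewrite !rmorphM /= -[in V _ _ (alpha _ _)]pa -[in V _ _ (beta _ _)]pb !S2 // pa pb.
  congr (_ ^+ _ * _ + _ ^+ _ * _); rewrite /alpha /beta expnS; lia.
- by rewrite neq_ltn ab.
move=> j jK ja jb; rewrite rmorphM /=.
have [lt|gt|E] := ltngtP (piv j) (2 ^ s - 1 + r)%N.
- by rewrite S1 ?mul0r.
- by rewrite ht ?mulr0.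
by have [Ej|Ej] := piv_eq hr E; rewrite Ej eqxx in ja jb.
Qed.

(** Downward induction on the pivot row. In each row b = false and b = true give two equations for
    the entries at [alpha] and [beta], with determinant a power of x times x^(2^s) - 1. *)
Lemma pivotal_inj e V (t : nat -> R) k1 : pivotal e V ->
  (forall b k, (k1 <= k < K e)%N -> rd (\sum_(j < K e) V b k j * t j) = 0) ->
  forall j, (j < K e)%N -> (k1 <= piv j)%N -> rd (t j) = 0.
Proof.
move=> pV hV.
suff H m : forall j, (j < K e)%N -> (k1 <= piv j)%N ->
    (2 ^ e - 1 - m <= piv j)%N -> rd (t j) = 0.
  by move=> j jK kj; apply: (H (2 ^ e - 1)%N j) => //; rewrite subnn.
elim: m => [|m IH] j jK kj mj.
  by have := piv_K jK; lia.
have [lt|ge] := ltnP (2 ^ e - 1 - m.+1)%N (piv j); first by apply: IH => //; lia.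
have pj := piv_K jK; have [s [r [se hr Ek]]] := row_pivot pj.
have s0 : (0 < 2 ^ s)%N by rewrite expn_gt0.
have ht j' : (j' < K e)%N -> (2 ^ s - 1 + r < piv j')%N -> rd (t j') = 0.
  by move=> j'K lt; apply: IH => //; lia.
have kK : (k1 <= 2 ^ s - 1 + r < K e)%N.
  by rewrite -Ek kj /=; move: pj; rewrite /K expnS; lia.
have E1 : rd (t (alpha s r)) + rd (t (beta s r)) = 0.
  by have := pivot_row false pV se hr ht; rewrite hV // rmorph1 !expr1n !mul1r => <-.
have E2 := pivot_row true pV se hr ht; rewrite hV //= map_polyX in E2.
have Ea : rd (t (alpha s r)) = - rd (t (beta s r)) by apply/eqP; rewrite -addr_eq0 E1.
have b0 : rd (t (beta s r)) = 0.
  move: E2; rewrite Ea mulrN addrC -mulrBl => /esym/eqP; rewrite mulf_eq0 subr_eq0.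
  case/orP=> /eqP // /(congr1 (fun p : {poly 'F_2} => size p)).
  rewrite !size_polyXn expnS; lia.
have [->|->] := piv_eq hr Ek => //.
by rewrite Ea b0 oppr0.
Qed.

Lemma pivotal_dv2 e V (t : nat -> R) m : pivotal e V ->
  (forall b k, (k < K e)%N -> dv2 m (\sum_(j < K e) V b k j * t j)) ->
  forall j, (j < K e)%N -> dv2 m (t j).
Proof.
move=> pV; elim: m t => [|m IH] t hV j jK; first exact: dv2_0.
have /choice[t' Et'] : forall i, exists w, (i < K e)%N -> t i = w *+ 2.
  move=> i; case: (ltnP i (K e)) => iK; last by exists 0.
  have [|w Ew] := @rd_eq0 (t i); last by exists w.
  apply: (@pivotal_inj e V t 0) => // b k /andP[_ kK].
  exact: (dv2S_rd (hV b k kK)).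
rewrite Et' //; apply/dv2_double; apply: IH => // b k kK.
apply/dv2_double; have := hV b k kK; rewrite (eq_bigr (fun i : 'I__ => V b k i * t' i *+ 2)).
  by rewrite sumrMnl.
by move=> i _; rewrite Et' // mulrnAr.
Qed.

(** * New columns *)

(** For c = [binomial n] this is phi_n(x_b t) as a matrix of shifts: the polynomial matrix of one
    family of defining relations. Other c are needed for half of phi. *)
Definition th (c : nat -> nat) (b : bool) (k j : nat) : R :=
  if (k <= j)%N then xvar b ^+ (j - k) *+ c (j - k).+1 else 0.

Lemma phi_mul_coef n b (G : {poly R}) k J : (k <= J)%N ->
  (phi n (xvar b) * G)`_(J - k)
  = \sum_(j < J.+1) th (binomial n) b k j * G`_(J - j).
Proof.
move=> kJ; rewrite coefM.
rewrite -(big_mkord xpredT (fun j => th (binomial n) b k j * G`_(J - j))).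
rewrite (@big_cat_nat _ _ _ k) //=; last by rewrite leqW.
rewrite [X in _ = X + _]big_nat [X in _ = X + _]big1 ?add0r => [|j /andP[_ jk]]; last first.
  by rewrite /th leqNgt jk mul0r.
rewrite -[X in \sum_(X <= _ < _) _]add0n big_addn subSn // big_mkord; apply: eq_bigr => j _.
rewrite /th leq_addl addnK subnDA subnAC; congr (_ * _).
rewrite coef_poly; case: ltnP => // le.
by rewrite bin_small ?ltnS // mulr0n.
Qed.

Lemma size_mulrn_exp2 (p : R) m : size (p *+ 2 ^ m) = size p.
Proof.
elim: m => [|m IH] //; rewrite expnSr mulrnA -[RHS]IH.
set q := p *+ _; apply/eqP; rewrite eqn_leq; apply/andP; split; apply/leq_sizeP => i hi.
  by rewrite coefMn nth_default // mul0rn.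
by apply: Z2loc_mulrn2_inj; rewrite mul0rn -coefMn nth_default.
Qed.

Lemma mulrn_exp2_inj m (p q : R) : p *+ 2 ^ m = q *+ 2 ^ m -> p = q.
Proof.
elim: m => [|m IH] //; rewrite expnSr !mulrnA => /R_mulrn2_inj; exact: IH.
Qed.

Lemma size_sum_leq (A : nzRingType) (I : Type) (r : seq I) (P : pred I)
    (F : I -> {poly A}) m :
  (forall i, P i -> (size (F i) <= m)%N) -> (size (\sum_(i <- r | P i) F i)%R <= m)%N.
Proof.
move=> h; apply: (big_ind (fun p : {poly A} => (size p <= m)%N)) => //.
  by rewrite size_poly0.
by move=> p q hp hq; rewrite (leq_trans (size_polyD _ _)) // geq_max hp hq.
Qed.

Lemma predn_add_leq (i j k m a b : nat) : (i <= j)%N -> (j < k)%N ->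
  (a <= (j - i).+1)%N -> (b <= (k + m - j).+1)%N ->
  ((a + b).-1 <= (k + m - i).+1)%N.
Proof. lia. Qed.

Section Extension.

Variables (e : nat) (V : bool -> nat -> nat -> R) (P : nat -> nat -> R).
Let n := (2 ^ e.+1)%N.
Hypothesis e0 : (0 < e)%N.
Hypothesis pV : pivotal e V.
Hypothesis P0 : forall i j, (j < K e)%N -> (j < i)%N -> P i j = 0.
Hypothesis sP : forall i j, (j < K e)%N -> (size (P i j) <= (j - i).+1)%N.
Hypothesis VP : forall b k i, (k < K e)%N -> (i < K e)%N ->
  (\sum_(j < K e) V b k j * P j i) *+ 2 = th (binomial n) b k i.

Let KE : K e = (n - 2)%N. Proof. by []. Qed.
Let nE : n = (2 ^ e + 2 ^ e)%N. Proof. by rewrite /n expnS mul2n addnn. Qed.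

Lemma rd_th_bin b k J : (k <= J)%N -> ((J - k).+1 <= n)%N ->
  rd (th (binomial n) b k J) = ((J - k).+1 == n)%:R * rd (xvar b) ^+ (J - k).
Proof.
move=> kJ le; rewrite /th kJ; case: eqP => [->|ne].
  by rewrite binn mulr1n rmorphXn mul1r.
have [|c [-> _]] := @bin_half e (J - k).+1; first by lia.
by rewrite mulrnA mulrnAC rd_mulrn2 mul0r.
Qed.

Variables (G : {poly R}) (M : nat) (u : R).
Hypothesis bG : bnd G.
Hypothesis G0 : G`_0 = u *+ 2 ^ M.
Hypothesis ru : rd u = 1.
Hypothesis hG : forall c j, (j < 3 * 2 ^ e - 2)%N ->
  dv2 M.+1 (phi n (xvar c) * G)`_j.

(** The contribution of the columns below K_e to a coefficient of phi G, with V split off by [VP].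
    In [tm] the new columns found so far are added. *)
Let tJ J i := \sum_(j < K e) P i j *+ 2 * G`_(J - j).
Let VC (C : nat -> nat -> R) b k r := \sum_(i < K e) V b k i * C i r.

Let tm C m i := tJ (K e + m) i + \sum_(1 <= r < m) C i r * G`_(m - r).

Let good m (C : nat -> nat -> R) := forall r, (r < m)%N ->
  [/\ forall i, (i < K e)%N -> (size (C i r) <= (K e + r - i).+1)%N,
      dv2 M G`_r &
      forall b k, (k < K e)%N -> rd (VC C b k r) = rd (th (binomial n) b k (K e + r))].

(** This is the coefficient of t^(K_e + m - k) in phi G. In the columns K_e + r with 0 < r < m, phi
    is replaced by V C: the error is even and is multiplied by a coefficient of G divisible by
    2^M. *)
Lemma V_tm C m b k : (k < K e)%N -> (0 < m < 2 ^ e)%N -> good m C ->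
  dv2 M.+1 (\sum_(i < K e) V b k i * tm C m i
    + th (binomial n) b k (K e) * G`_m + th (binomial n) b k (K e + m) * G`_0).
Proof.
move=> kK /andP[m0 me] gC.
have kJ : (k <= K e + m)%N by lia.
have := hG b (j := (K e + m - k)%N); rewrite phi_mul_coef // => /(_ _)/= H.
have {}H := H ltac:(by rewrite KE nE in kK *; lia).
pose D r := th (binomial n) b k (K e + r) - VC C b k r.
suff -> : \sum_(i < K e) V b k i * tm C m i + th (binomial n) b k (K e) * G`_m
   + th (binomial n) b k (K e + m) * G`_0
   = \sum_(j < (K e + m).+1) th (binomial n) b k j * G`_(K e + m - j)
     - \sum_(1 <= r < m) D r * G`_(m - r).
  apply: dv2B => //; rewrite big_nat_cond; apply: dv2_sum => r /andP[/andP[r0 rm] _].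
  have [_ _ hr] := gC r rm; have [_ [w ->] _] := gC (m - r)%N ltac:(lia).
  have [|v ->] := @rd_eq0 (D r); first by rewrite rmorphB /= hr // subrr.
  by exists (v * w); rewrite mulrnAl mulrnAr -mulrnA -expnSr.
have -> : \sum_(i < K e) V b k i * tm C m i
    = \sum_(j < K e) th (binomial n) b k j * G`_(K e + m - j)
      + \sum_(1 <= r < m) VC C b k r * G`_(m - r).
  rewrite /tm (eq_bigr _ (fun i _ => mulrDr _ _ _)) big_split /=; congr (_ + _).
    rewrite /tJ (eq_bigr _ (fun i _ => mulr_sumr _ _ _ _)) exchange_big /=.
    apply: eq_bigr => j _; rewrite -VP // -sumrMnl mulr_suml; apply: eq_bigr => i _.
    by rewrite mulrA mulrnAr.
  rewrite (eq_bigr _ (fun i _ => mulr_sumr _ _ _ _)) exchange_big /=.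
  apply: eq_bigr => r _; rewrite /VC mulr_suml; apply: eq_bigr => i _.
  by rewrite mulrA.
rewrite -addnS big_split_ord /=.
rewrite [X in _ = _ + X - _](_ : _ = th (binomial n) b k (K e) * G`_m
   + \sum_(1 <= r < m) th (binomial n) b k (K e + r) * G`_(m - r)
   + th (binomial n) b k (K e + m) * G`_0); last first.
  rewrite -(big_mkord xpredT (fun i => th (binomial n) b k (K e + i) *
     G`_(K e + m - (K e + i)))) big_nat_recr //= big_ltn //= addn0.
  rewrite addKn subnn; congr (_ + _ + _).
  by apply: eq_bigr => r _; rewrite subnDl.
rewrite (eq_bigr _ (fun r _ => mulrBl _ _ _)) sumrB /=; ring.
Qed.
(** The exponent is raised one step at a time, first for [tm], because in [V_tm] the factor of G_m
    is even, and then for G_m itself. *)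
Lemma dv2_tm C m : (0 < m < 2 ^ e)%N -> good m C ->
  dv2 M G`_m /\ forall i, (i < K e)%N -> dv2 M (tm C m i).
Proof.
move=> hm gC; have /andP[m0 me] := hm.
suff H M' : (M' <= M)%N -> dv2 M' G`_m /\ forall i, (i < K e)%N -> dv2 M' (tm C m i).
  exact: (H M).
elim: M' => [|M' IH] lt; first by split=> *; apply: dv2_0.
have [IHG IHt] := IH (ltnW lt).
have dvM t : dv2 M.+1 t -> dv2 M'.+1 t.
  move=> [w ->]; exists (w *+ 2 ^ (M - M')); rewrite -mulrnA -expnD.
  by congr (_ *+ 2 ^ _); lia.
have dvM2 t : dv2 M t -> dv2 M'.+1 t.
  move=> [w ->]; exists (w *+ 2 ^ (M - M'.+1)); rewrite -mulrnA -expnD.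
  by congr (_ *+ 2 ^ _); lia.
have dG0 : dv2 M'.+1 G`_0 by apply: dvM2; exists u.
have dt i : (i < K e)%N -> dv2 M'.+1 (tm C m i).
  apply: (pivotal_dv2 pV) => b k kK; have := V_tm b kK hm gC.
  set S := \sum_(_ < _) _; move=> /dvM H.
  have -> : S = S + th (binomial n) b k (K e) * G`_m
       + th (binomial n) b k (K e + m) * G`_0
       - th (binomial n) b k (K e + m) * G`_0 - th (binomial n) b k (K e) * G`_m by ring.
  apply: dv2B; first by apply: dv2B => //; apply: dv2M.
  have kK' := ltnW kK; rewrite /th kK'.
  have [|c [-> _]] := @bin_half e (K e - k).+1; first by rewrite KE in kK *; lia.
  by rewrite mulnC mulrnA mulrnAl; apply/dv2_double; apply: dv2M.
split=> //.
(* All pivots lie above this row, so V is even in it and the relation can be halved. The factor of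
   G_m there is C(n, 2^e), whose half is odd. *)
pose k0 := (2 ^ e - 1)%N.
have e1 : (2 <= 2 ^ e)%N by rewrite -[2%N]/(2 ^ 1)%N leq_exp2l.
have k0K : (k0 < K e)%N by rewrite KE nE /k0; lia.
have := V_tm false k0K hm gC; rewrite /th (ltnW k0K) (_ : (k0 <= K e + m)%N); last by lia.
have [|c [-> oc]] := @bin_half e (K e - k0).+1; first by rewrite KE nE /k0; lia.
have [|c' [-> _]] := @bin_half e (K e + m - k0).+1; first by rewrite KE nE /k0; lia.
rewrite /xvar !expr1n.
have /choice[W EW] : forall i, exists w, (i < K e)%N -> V false k0 i = w *+ 2.
  move=> i; case: (ltnP i (K e)) => iK; last by exists 0.
  have [|w Ew] := @rd_eq0 (V false k0 i); last by exists w.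
  by have [S1 _ _] := pV; apply: S1 => //; apply: piv_K.
rewrite (eq_bigr (fun i : 'I__ => W i * tm C m i *+ 2)) => [|i _]; last first.
  by rewrite EW // mulrnAl.
rewrite sumrMnl !mulrnA !mulrnAl -!mulrnA !(mulnC 2) !mulrnA.
rewrite -!mulrnDl => /dv2_double H.
have {H} : dv2 M'.+1 (G`_m *+ c).
  have -> : G`_m *+ c = \sum_(i < K e) W i * tm C m i + 1 * G`_m *+ c + 1 * G`_0 *+ c'
      - \sum_(i < K e) W i * tm C m i - 1 * G`_0 *+ c' by ring.
  apply: dv2B; last by rewrite -mulr_natl; apply: dv2M; rewrite mul1r.
  by apply: dv2B; [exact: dvM2 | apply: dv2_sum => i _; apply: dv2M; apply: dt].
have -> : c = (c./2.*2.+1)%N.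
  rewrite -[LHS]odd_double_half oc (_ : (_ == _) = true) //.
  by apply/eqP; rewrite KE nE /k0; lia.
rewrite -muln2 mulrS mulrnA => H.
rewrite -[G`_m](addrK (G`_m *+ c./2 *+ 2)); apply: dv2B => //.
by apply/dv2_double; rewrite -mulr_natl; apply: dv2M.
Qed.

Lemma extension_good m : (m <= 2 ^ e)%N -> exists C, good m C.
Proof.
elim: m => [|m IH] hm; first by exists (fun _ _ => 0).
have [C gC] := IH (ltnW hm); have [m0|m0] := posnP m.
  (* Column K_e gets zero: phi is even in it, since only binomials C(n, K_e - k + 1) with K_e - k +
     1 < n occur. *)
  exists (fun _ _ => 0) => r; rewrite m0 ltnS leqn0 => /eqP ->; split.
  - by move=> *; rewrite size_poly0.
  - by exists u.
  move=> b k kK; rewrite /VC big1 ?rmorph0 => [|i _]; last by rewrite mulr0.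
  rewrite addn0 rd_th_bin; [|by lia|by rewrite KE; lia].
  by rewrite (_ : (_ == _) = false) ?mul0r //; apply/eqP; rewrite KE in kK *; lia.
have hm' : (0 < m < 2 ^ e)%N by rewrite m0.
have [dG dt] := dv2_tm hm' gC.
have /choice[W EW] : forall i, exists w, (i < K e)%N -> tm C m i = w *+ 2 ^ M.
  move=> i; case: (ltnP i (K e)) => iK; last by exists 0.
  by have [w Ew] := dt i iK; exists w.
(* After division of [V_tm] by 2^M the term of G_m is even, and G_0 has become u, which is 1 modulo
   2; so V W is minus the right-hand side. *)
exists (fun i r => if r == m then - W i else C i r) => r; rewrite ltnS leq_eqVlt.
have [-> _|ne /gC[h1 h2 h3]] := eqVneq r m; last first.
  by split; rewrite ?(negbTE ne) // => b k kK; rewrite -h3 // /VC (negbTE ne).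
split=> //.
  move=> i iK; rewrite size_polyN -(size_mulrn_exp2 _ M) -EW //.
  rewrite (leq_trans (size_polyD _ _)) // geq_max; apply/andP; split.
    apply: size_sum_leq => j _.
    case: (ltnP j i) => ji; first by rewrite P0 ?ltn_ord // mul0rn mul0r size_poly0.
    rewrite (leq_trans (size_polyMleq _ _)) //.
    have := size_mulrn_exp2 (P i j) 1; rewrite expn1 => ->.
    exact: predn_add_leq ji (ltn_ord j) (sP i (ltn_ord j)) (bG _).
  rewrite big_nat_cond; apply: size_sum_leq => r' /andP[/andP[r0 rm] _].
  rewrite (leq_trans (size_polyMleq _ _)) //.
  have [h _ _] := gC r' rm; have hi := h i iK; move: hi (bG (m - r')%N) iK rm.
  by move: (size _) (size _) => a a'; clear; lia.
move=> b k kK; rewrite /VC (eq_bigr (fun i : 'I__ => - (V b k i * W i))); last first.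
  by move=> i _; rewrite eqxx mulrN.
rewrite sumrN; set S := \sum_(_ < _) _.
have [w Ew] := V_tm b kK hm' gC.
have [v Ev] := dG.
have ES : \sum_(i < K e) V b k i * tm C m i = S *+ 2 ^ M.
  by rewrite -sumrMnl; apply: eq_bigr => i _; rewrite EW // mulrnAr.
rewrite ES G0 Ev !mulrnAr -!mulrnDl expnS mulrnA in Ew.
move/mulrn_exp2_inj: Ew => /(congr1 (fun p : R => rd p)); rewrite rd_mulrn2.
rewrite !rmorphD !rmorphM /= ru mulr1 rd_th_bin; [|by lia|by rewrite KE; lia].
rewrite (_ : (_ == n) = false) ?mul0r ?addr0; last by apply/eqP; rewrite KE in kK *; lia.
by move=> /eqP; rewrite addr_eq0 => /eqP E; rewrite rmorphN /= E opprK.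
Qed.

End Extension.

Lemma extension e (V : bool -> nat -> nat -> R) (P : nat -> nat -> R) :
  (0 < e)%N -> pivotal e V ->
  (forall i j, (j < K e)%N -> (j < i)%N -> P i j = 0) ->
  (forall i j, (j < K e)%N -> (size (P i j) <= (j - i).+1)%N) ->
  (forall b k i, (k < K e)%N -> (i < K e)%N ->
    (\sum_(j < K e) V b k j * P j i) *+ 2 = th (binomial (2 ^ e.+1)) b k i) ->
  exists C : nat -> nat -> R, forall r, (r < 2 ^ e)%N ->
    (forall i, (i < K e)%N -> (size (C i r) <= (K e + r - i).+1)%N) /\
    (forall b k, (k < K e)%N -> rd (\sum_(i < K e) V b k i * C i r)
       = rd (th (binomial (2 ^ e.+1)) b k (K e + r))).
Proof.
move=> e0 pV P0 sP VP; have [G [M [u [bG G0 ru hG]]]] := dual_series e.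
have [C gC] := extension_good e0 pV P0 sP VP bG G0 ru hG (leqnn _).
by exists C => r /gC[h1 _ h2].
Qed.

(** * The reduced matrix *)

(** Column K_(s+1) + 2^s + r as it is when first added, at stage s + 1, without its diagonal
    entry. *)
Definition qcol (q : nat -> nat -> R) s r i : R :=
  if (i < beta s r)%N then q i (K s.+1 + 2 ^ s + r)%N
  else if i == beta s r then pgeom 3 (2 ^ s) else 0.

(** Column j at the stage at which it is added; every later stage doubles it, whence the power of 2
    in [Pmat]. *)
Definition base (q : nat -> nat -> R) i j : R :=
  let s := trunc_log 2 (rho j) in let r := (rho j - 2 ^ s)%N in
  if i == j then (if (rho j < 2 ^ lev j)%N then 2 else 1)
  else if (rho j == 0%N) || (2 ^ lev j <= rho j)%N then 0
  else if (i < beta s r)%N then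
    pgeom (2 ^ (lev j - s) - 1) (2 ^ s.+1) * q i (K s.+1 + 2 ^ s + r)%N
  else if i == beta s r then pgeom (2 ^ (lev j - s).+1 - 1) (2 ^ s)
  else 0.

Definition Pmat e q i j : R := base q i j *+ 2 ^ (e - 1 - lev j).

Lemma lev_rhoK t r : (r < 2 ^ t.+1)%N -> lev (K t + r) = t /\ rho (K t + r) = r.
Proof. exact: lev_rho. Qed.

Lemma base_diag q t r : (r < 2 ^ t.+1)%N ->
  base q (K t + r) (K t + r) = if (r < 2 ^ t)%N then 2 else 1.
Proof. by move=> hr; have [l1 l2] := lev_rhoK hr; rewrite /base eqxx l1 l2. Qed.

Lemma base_zero q t r i : (r == 0 \/ 2 ^ t <= r)%N -> (r < 2 ^ t.+1)%N ->
  i != (K t + r)%N -> base q i (K t + r) = 0.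
Proof.
move=> h hr ne; have [l1 l2] := lev_rhoK hr.
by rewrite /base (negbTE ne) l1 l2; case: h => ->; rewrite ?orbT.
Qed.

Lemma base_new q t s r i : (s < t)%N -> (r < 2 ^ s)%N ->
  i != (K t + 2 ^ s + r)%N ->
  base q i (K t + 2 ^ s + r) = 
    if (i < beta s r)%N then
      pgeom (2 ^ (t - s) - 1) (2 ^ s.+1) * q i (K s.+1 + 2 ^ s + r)%N
    else if i == beta s r then pgeom (2 ^ (t - s).+1 - 1) (2 ^ s) else 0.
Proof.
move=> st hr; rewrite -addnA => ne.
have st' : (2 * 2 ^ s <= 2 ^ t)%N by rewrite -expnS pow2_ltP.
have s0 : (0 < 2 ^ s)%N by rewrite expn_gt0.
have [|l1 l2] := @lev_rhoK t (2 ^ s + r); first by rewrite expnS; lia.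
have tl : trunc_log 2 (2 ^ s + r) = s.
  by apply: trunc_log_eq => //; rewrite leq_addr expnS; lia.
have f1 : (2 ^ s + r == 0)%N = false by apply/eqP; lia.
have f2 : (2 ^ t <= 2 ^ s + r)%N = false by apply/negbTE; rewrite -ltnNge; lia.
by rewrite /base (negbTE ne) l1 l2 tl f1 f2 addKn.
Qed.

Lemma colP j : exists t, (exists2 r, (r == 0 \/ 2 ^ t <= r)%N &
    (r < 2 ^ t.+1)%N /\ j = (K t + r)%N)
  \/ (exists s r, [/\ (s < t)%N, (r < 2 ^ s)%N & j = (K t + 2 ^ s + r)%N]).
Proof.
have [Ej hr] := levP j; set t := lev j in Ej hr; exists t.
have t0 : (2 <= 2 ^ t.+1)%N by rewrite -[2%N]/(2 ^ 1)%N leq_exp2l.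
have jE : j = (K t + rho j)%N by rewrite /K; lia.
have [r0|r0] := posnP (rho j); first by left; exists (rho j); [left; apply/eqP | split].
have [lt|ge] := ltnP (rho j) (2 ^ t); last by left; exists (rho j); [right | split].
right; have /andP[lo hi] := @trunc_log_bounds 2 (rho j) isT r0.
set s := trunc_log _ _ in lo hi; exists s, (rho j - 2 ^ s)%N; split.
- by rewrite -(ltn_exp2l _ _ (isT : 1 < 2)%N); lia.
- by rewrite expnS in hi; lia.
by lia.
Qed.

Lemma lev_lt e j : (j < K e)%N -> (lev j < e)%N.
Proof.
have [Ej hr] := levP j => h; rewrite ltnNge; apply/negP => le.
have : (2 ^ e.+1 <= 2 ^ (lev j).+1)%N by rewrite leq_exp2l.
by rewrite /K in h; lia.
Qed.

Lemma pgeomE n m : pgeom n m = geo n ('X^m).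
Proof. by rewrite /pgeom -[LHS]/(comp_poly _ _) rmorph_sum; apply: eq_bigr => i _;
  rewrite rmorphXn /= comp_polyX. Qed.

Lemma rd_pgeom n m : rd (pgeom n m) = geo n ('X^m).
Proof. by rewrite pgeomE rmorph_geo rmorphXn /= map_polyX. Qed.

Lemma size_pgeom n m : (size (pgeom n m) <= (m * n.-1).+1)%N.
Proof.
rewrite pgeomE; apply: size_sum_leq => i _; rewrite -exprM size_polyXn ltnS.
by rewrite leq_mul2l -ltnS (leq_trans (ltn_ord i)) ?leqSpred ?orbT.
Qed.

(* Column K (s + 1) + 2^s + r is column j = 2^t + 2^(t-2) - 2 + r of (iii), with *)
(* t = s + 2; the first equation is the overlap with (ii).                      *)
Definition qok m (q : nat -> nat -> R) := forall s r, (s < m)%N -> (r < 2 ^ s)%N ->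
  q (alpha s r) (K s.+1 + 2 ^ s + r)%N = 'X^(2 ^ s) + 'X^(2 ^ s.+1) /\
  forall i, (i < beta s r)%N ->
    (size (q i (K s.+1 + 2 ^ s + r)%N) <= (K s.+1 + 2 ^ s + r - i).+1)%N.

Lemma K2 t : (K t + 2 = 2 * 2 ^ t)%N.
Proof. by rewrite /K -expnS subnK // -[2%N]/(2 ^ 1)%N leq_exp2l. Qed.

Lemma beta_new s t r : (s < t)%N -> (r < 2 ^ s)%N ->
  (beta s r + (2 ^ s * (2 ^ (t - s).+1 - 2)) = K t + 2 ^ s + r)%N.
Proof.
move=> st hr; rewrite mulnBr -expnD (_ : (s + _ = t.+1)%N); last by lia.
have := pow2_ltP st; have := K2 t; rewrite /beta !expnS.
have : (0 < 2 ^ s)%N by rewrite expn_gt0.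
by lia.
Qed.

Lemma base_lower q i j : (j < i)%N -> base q i j = 0.
Proof.
have [t [[r h [hr ->]]|[s [r [st hr ->]]]]] := colP j => ji.
  by apply: base_zero => //; rewrite neq_ltn ji orbT.
rewrite base_new //; last by rewrite neq_ltn ji orbT.
have := beta_new st hr => hb.
have bi : (beta s r < i)%N by apply: leq_ltn_trans ji; rewrite -hb leq_addr.
by rewrite ltnNge (ltnW bi) (gtn_eqF bi).
Qed.

Lemma size_base m q i j : qok m q -> (j < K m.+1)%N ->
  (size (base q i j) <= (j - i).+1)%N.
Proof.
move=> hq jK; have [<-|ne] := eqVneq i j.
  by rewrite /base eqxx; case: ifP => _; rewrite ?size_poly1 // -polyC_natr
     (leq_trans (size_polyC_leq1 _)).
have [t [[r h [hr Ej]]|[s [r [st hr Ej]]]]] := colP j.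
  by rewrite Ej base_zero ?size_poly0 // -Ej.
have tm : (s < m)%N.
  have := lev_lt jK; rewrite Ej -addnA.
  have [|-> _] := @lev_rhoK t (2 ^ s + r); last by lia.
  by have := pow2_ltP st; rewrite !expnS; lia.
rewrite Ej base_new // -?Ej //; have [_ hb] := hq s r tm hr.
case: ltnP => ib.
  apply: leq_trans (size_polyMleq _ _) _.
  have := size_pgeom (2 ^ (t - s) - 1) (2 ^ s.+1); have := hb i ib.
  move: (size _) (size _) => a a' h1 h2.
  have := beta_new st hr; have := beta_new (ltnSn s) hr; rewrite subSnn.
  have Em : (2 ^ s.+1 * (2 ^ (t - s) - 1).-1 = 2 ^ s * (2 ^ (t - s).+1 - 2) - 2 ^ s * 2)%N.
    rewrite -mulnBr [(2 ^ s.+1)%N]expnS [(2 ^ (t - s).+1)%N]expnS (mulnC 2) -mulnA.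
    by congr (_ * _)%N; have := leq_exp2l 1 (t - s) (isT : 1 < 2)%N; rewrite subn_gt0 st; lia.
  rewrite Em in h2; rewrite (_ : 2 ^ 2 - 2 = 2)%N // => e1 e2.
  have e3 : (K s.+1 <= K t)%N by rewrite leq_sub2r // leq_exp2l.
  move: h1 h2 e1 e2 ib e3; rewrite Ej.
  by move: (2 ^ s)%N (2 ^ s * (_ - _))%N (2 ^ s * 2)%N => *; lia.
case: eqP => [->|_]; last by rewrite size_poly0.
apply: leq_trans (size_pgeom _ _) _; rewrite Ej -(beta_new st hr) addKn ltnS.
by rewrite -subn1 -subnDA.
Qed.

(** * Induction on e *)

Lemma sum_ord_cut (A : nmodType) m n (F : nat -> A) : (m <= n)%N ->
  (forall j, (m <= j < n)%N -> F j = 0) -> \sum_(j < n) F j = \sum_(j < m) F j.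
Proof.
move=> mn h; rewrite -!(big_mkord xpredT F) (@big_cat_nat _ _ _ m 0 n) //=.
by rewrite [X in _ + X]big_nat [X in _ + X]big1 ?addr0.
Qed.

Lemma sum_ord_ext (A : nmodType) m n (F : nat -> A) i : (m <= i < n)%N ->
  (forall j, (m <= j < n)%N -> j != i -> F j = 0) ->
  \sum_(j < n) F j = \sum_(j < m) F j + F i.
Proof.
move=> /andP[mi ilt] h; rewrite (@sum_ord_cut _ i.+1 n) // => [|j /andP[ij jn]].
  rewrite big_ord_recr /= (@sum_ord_cut _ m i) // => j /andP[mj ji].
  by apply: h; rewrite ?(ltn_trans ji) ?mj // (ltn_eqF ji).
by apply: h; rewrite ?jn ?andbT ?(leq_trans mi (ltnW ij)) // (gtn_eqF ij).
Qed.

Lemma rd_mulrn (p : R) c : rd (p *+ c) = rd p *+ odd c.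
Proof.
rewrite -{1}(odd_double_half c) mulrnDr -muln2 mulrnA rmorphD.
by rewrite -[X in _ + X]/(rd _) rd_mulrn2 addr0 rmorphMn.
Qed.

Lemma rd_th c b k j : (k <= j)%N ->
  rd (th c b k j) = rd (xvar b) ^+ (j - k) *+ odd (c (j - k).+1).
Proof. by move=> kj; rewrite /th kj rd_mulrn rmorphXn. Qed.

(** [qcol] still solves the system for which it was made at stage s + 1. The right-hand side does
    not involve e, so this survives the passage to e + 1. *)
Definition stab e q (V : bool -> nat -> nat -> R) s r := forall b k, (k < K e)%N ->
  rd (\sum_(i < K e) V b k i * qcol q s r i)
  = rd (xvar b) ^+ (2 ^ s.+2 - 1)%N *+ (k == 2 ^ s - 1 + r)%N.

Lemma geo3 (A : pzSemiRingType) (x : A) : geo 3 x = 1 + x + x ^+ 2.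
Proof. by rewrite /geo !big_ord_recr big_ord0 /= add0r expr0 expr1. Qed.

Lemma geo_odd (A : comNzRingType) m (x : A) :
  geo (2 * m).+1 x = geo m (x ^+ 2) * (1 + x) + x ^+ (2 * m).
Proof.
elim: m => [|m IH]; first by rewrite /geo big_ord0 muln0 big_ord1 mul0r add0r.
rewrite mulnS /geo !big_ord_recr /= -/(geo (2 * m) x) -/(geo m (x ^+ 2)).
move: IH; rewrite /geo !big_ord_recr /= -/(geo (2 * m) x) -/(geo m (x ^+ 2)) => IH.
rewrite IH !add2n -exprM !exprS; ring.
Qed.

(* The column of V C is affine in x^M when the right-hand side of the system   *)
(* is (e_k, x^M e_k); it is the pivot for M = 2^(s+1) - 1 and [qcol] for       *)
(* M = 2^(s+2) - 1, whence the geometric factors for M = 2^(t+1) - 1.          *)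
Lemma stab_base e q V s r : pivotal e V -> (s < e)%N -> (r < 2 ^ s)%N ->
  stab e q V s r -> forall b k, (k < K e)%N ->
  rd (\sum_(i < K e) V b k i * base q i (K e + 2 ^ s + r)%N)
  = rd (xvar b) ^+ (2 ^ e.+1 - 1)%N *+ (k == 2 ^ s - 1 + r)%N.
Proof.
move=> [S1 S2 S3] se hr hq b k kK; have [ab bK] := alpha_beta_K hr se.
have [pb ib] := piv_beta hr.
set m := (2 ^ (e - s) - 1)%N.
(* The column is A times [qcol] plus D times the unit vector at [beta s r], on which V gives just
   the pivot. *)
pose A := geo m ('X^(2 ^ s.+1)) : {poly 'F_2}.
pose D := geo (2 ^ (e - s).+1 - 1) ('X^(2 ^ s)) - A * geo 3 ('X^(2 ^ s)) : {poly 'F_2}.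
have E i : (i < K e)%N -> rd (V b k i * base q i (K e + 2 ^ s + r)%N)
   = A * rd (V b k i * qcol q s r i) + (if i == beta s r then D * rd (V b k i) else 0).
  move=> iK; rewrite base_new //; last by rewrite neq_ltn -addnA ltn_addr.
  rewrite /qcol !rmorphM /=; case: (ltngtP i (beta s r)) => [lt|gt|Eq].
  - by rewrite rmorphM /= rd_pgeom addr0 mulrCA.
  - by rewrite rmorph0 !mulr0 addr0.
  by rewrite !rd_pgeom /D; ring.
have {}E : rd (\sum_(i < K e) V b k i * base q i (K e + 2 ^ s + r)%N)
   = A * rd (\sum_(i < K e) V b k i * qcol q s r i) + D * rd (V b k (beta s r)).
  rewrite !rmorph_sum /=; under eq_bigr => i _ do rewrite (E i (ltn_ord i)).
  rewrite big_split /= -mulr_sumr; congr (_ + _).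
  rewrite (bigD1 (Ordinal bK)) //= eqxx big1 ?addr0 // => i.
  by rewrite -val_eqE /= => /negbTE ->.
rewrite E hq //.
have [Ek|ne] := eqVneq k (2 ^ s - 1 + r)%N; last first.
  by rewrite S3 ?mulr0 ?add0r ?pb // mulr0.
rewrite {1}Ek -pb S2 // pb.
have s0 : (0 < 2 ^ s)%N by rewrite expn_gt0.
have -> : (beta s r - (2 ^ s - 1 + r) = 2 ^ s.+1 - 1)%N by rewrite /beta expnS; lia.
rewrite !mulr1n.
set Z := 'X^(2 ^ s) : {poly 'F_2}.
have EZ : 'X^(2 ^ s.+1) = Z ^+ 2 :> {poly 'F_2} by rewrite -exprM -expnSr.
have m1 : (1 < 2 ^ (e - s))%N by rewrite -[1%N]/(2 ^ 0)%N ltn_exp2l // subn_gt0.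
have Eodd : (2 ^ (e - s).+1 - 1 = (2 * m).+1)%N by rewrite expnS /m; lia.
have HA : (Z ^+ 2 - 1) * A = Z ^+ (2 * m) - 1.
  by rewrite /A EZ /geo -subrX1 -exprM.
have ED : D = Z ^+ (2 * m) - Z ^+ 2 * A.
  by rewrite /D Eodd geo_odd geo3 -EZ -/A EZ -/Z; ring.
rewrite ED; clear E; case: b => /=; last first.
  rewrite rmorph1 !expr1n; transitivity (Z ^+ (2 * m) - (Z ^+ 2 - 1) * A); first by ring.
  by rewrite HA; ring.
rewrite map_polyX.
have E1 : 'X^(2 ^ s.+2 - 1) = 'X^(2 ^ s.+1 - 1) * Z ^+ 2 :> {poly 'F_2}.
  by rewrite -EZ -exprD; congr ('X^_); rewrite !expnS; lia.
have -> : 'X^(2 ^ e.+1 - 1) = 'X^(2 ^ s.+1 - 1) * Z ^+ (2 * m) :> {poly 'F_2}.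
  rewrite -exprM -exprD; congr ('X^_).
  have -> : (2 ^ e.+1 = 2 ^ s.+1 * 2 ^ (e - s))%N by rewrite -expnD; congr (2 ^ _)%N; lia.
  rewrite /m expnS; move: m1; move: (2 ^ s)%N (2 ^ (e - s))%N s0 => a c; nia.
by rewrite E1; ring.
Qed.

Lemma odd_bin_exp2 N m : (0 < m)%N -> odd 'C(2 ^ N, m) = (m == 2 ^ N)%N.
Proof.
move=> m0; case: (ltngtP m (2 ^ N)%N) => [lt|gt|->]; last by rewrite binn.
  have lm : (logn 2 m < N)%N by rewrite logn2_lt ?m0.
  have [|//|_] := @odd_bin_exp2_div N 0 m; first by rewrite m0 ltnW.
    by rewrite add0n ltnW.
  by rewrite expn0 divn1 subn0 => ->; rewrite ltn_eqF.
by rewrite bin_small.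
Qed.

Lemma rd_th_col (c : nat -> nat) b k e p : (k < K e)%N -> (0 < p)%N ->
  (forall m, (0 < m)%N -> odd (c m) = (m == 2 ^ e.+1)%N) ->
  rd (th c b k (K e + p)) = rd (xvar b) ^+ (2 ^ e.+1 - 1)%N *+ (k == p - 1)%N.
Proof.
move=> kK p0 hc; have e2 : (2 <= 2 ^ e.+1)%N by rewrite -[2%N]/(2 ^ 1)%N leq_exp2l.
rewrite rd_th ?hc //; last by lia.
have -> : ((K e + p - k).+1 == 2 ^ e.+1)%N = (k == p - 1)%N.
  by apply/eqP/eqP; rewrite /K in kK *; lia.
case: eqP => [->|_]; last by rewrite !mulr0n.
by congr (_ ^+ _ *+ _); rewrite /K; lia.
Qed.

Lemma gt_beta_piv s r i : (r < 2 ^ s)%N -> (i < K s.+1)%N -> (beta s r < i)%N ->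
  (2 ^ s - 1 + r < piv i)%N.
Proof.
move=> hr iK bi; have [s' [r' [hr' -> Ei]]] := pivP i.
have a0 : (0 < 2 ^ s)%N by rewrite expn_gt0.
have a1 : (0 < 2 ^ s')%N by rewrite expn_gt0.
have s's : (s' <= s)%N.
  rewrite leqNgt; apply/negP => /pow2_ltP; move: iK; rewrite /K.
  by case: Ei => ->; rewrite /alpha /beta !expnS; lia.
case: (ltngtP s' s) s's => // [lt|Es] _.
  by have := pow2_ltP lt; case: Ei bi => ->; rewrite /alpha /beta !expnS; lia.
by move: Ei bi hr'; rewrite Es => -[] ->; rewrite /alpha /beta ?expnS; lia.
Qed.

(** With Z = x^(2^s), the row of the right-hand side gives t_alpha + t_beta = 1 and t_alpha + Z
    t_beta = Z^3. Hence t_beta = 1 + Z + Z^2, the entry of (i), and t_alpha = Z + Z^2, the entry of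
    (ii). *)
Lemma last_column s r V (t : nat -> R) : (r < 2 ^ s)%N -> pivotal s.+1 V ->
  (forall b k, (k < K s.+1)%N -> rd (\sum_(i < K s.+1) V b k i * t i)
     = rd (xvar b) ^+ (2 ^ s.+2 - 1)%N *+ (k == 2 ^ s - 1 + r)%N) ->
  [/\ rd (t (alpha s r)) = 'X^(2 ^ s) + 'X^(2 ^ s.+1),
      rd (t (beta s r)) = geo 3 ('X^(2 ^ s)) &
      forall i, (i < K s.+1)%N -> (beta s r < i)%N -> rd (t i) = 0].
Proof.
move=> hr pV ht.
have h0 i : (i < K s.+1)%N -> (2 ^ s - 1 + r < piv i)%N -> rd (t i) = 0.
  move=> iK; apply: (pivotal_inj pV) => // b k /andP[lt kK].
  by rewrite ht // (gtn_eqF lt).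
have s0 : (0 < 2 ^ s)%N by rewrite expn_gt0.
have kK : (2 ^ s - 1 + r < K s.+1)%N by rewrite /K !expnS; lia.
set Z := 'X^(2 ^ s) : {poly 'F_2}.
have EZ : 'X^(2 ^ s.+1) = Z ^+ 2 :> {poly 'F_2} by rewrite -exprM -expnSr.
have E1 : rd (t (alpha s r)) + rd (t (beta s r)) = 1.
  have := pivot_row false pV (ltnSn s) hr h0; rewrite ht // eqxx.
  by rewrite rmorph1 !expr1n !mul1r mulr1n => <-.
have E2 : rd (t (alpha s r)) + Z * rd (t (beta s r)) = Z ^+ 3.
  have := pivot_row true pV (ltnSn s) hr h0; rewrite ht // eqxx /= map_polyX mulr1n.
  have nz : 'X^(2 ^ s - 1) != 0 :> {poly 'F_2} by rewrite monic_neq0 ?monicXn.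
  have -> : 'X^(2 ^ s.+2 - 1) = 'X^(2 ^ s - 1) * Z ^+ 3 :> {poly 'F_2}.
    by rewrite -exprM -exprD; congr ('X^_); rewrite !expnS; lia.
  have -> : 'X^(2 ^ s.+1 - 1) = 'X^(2 ^ s - 1) * Z :> {poly 'F_2}.
    by rewrite -exprD; congr ('X^_); rewrite !expnS; lia.
  by rewrite -mulrA -mulrDr => /(mulfI nz).
have nz : Z - 1 != 0.
  by rewrite -polyC1 monic_neq0 // monicXnsubC.
have Eb : rd (t (beta s r)) = geo 3 Z.
  apply: (mulfI nz); rewrite geo3; transitivity (Z ^+ 3 - 1); last by ring.
  by rewrite -E2 -[rd (t (alpha s r))](addrK (rd (t (beta s r)))) E1; ring.
have p2 : 2%N \in [pchar {poly 'F_2}] by rewrite pchar_poly pchar_Fp.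
split=> //.
  rewrite EZ -[LHS](addrK (rd (t (beta s r)))) E1 Eb geo3 (oppr_pchar2 p2).
  have E0 : 1 + 1 = 0 :> {poly 'F_2} := addrr_pchar2 p2 1.
  by rewrite -[1 + Z + _]addrA [LHS]addrA E0 add0r.
by move=> i iK bi; apply: h0 => //; apply: gt_beta_piv.
Qed.

Lemma eq_base e q q' i j : (forall i' j', (j' < K e)%N -> q' i' j' = q i' j') ->
  (j < K e)%N -> base q' i j = base q i j.
Proof.
have [->|ne] := eqVneq i j; first by rewrite /base eqxx.
move=> h jK; have [t [[r hr [rt Ej]]|[s [r [st hr Ej]]]]] := colP j.
  by rewrite Ej !base_zero // -Ej.
rewrite Ej !base_new -?Ej // h //.
suff : (K s.+1 <= K t)%N by lia.
by rewrite leq_sub2r // leq_exp2l.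
Qed.

Lemma eq_qcol e q q' s r i : (s.+1 < e)%N -> (r < 2 ^ s)%N ->
  (forall i' j', (j' < K e)%N -> q' i' j' = q i' j') ->
  qcol q' s r i = qcol q s r i.
Proof.
move=> se hr h; rewrite /qcol h //.
have : (K s.+2 <= K e)%N by rewrite leq_sub2r // leq_exp2l.
by rewrite /K !expnS; have : (0 < 2 ^ s)%N by [rewrite expn_gt0]; lia.
Qed.

(** The invariant of the induction. On the first K_e columns phi_(e+1) has only even coefficients,
    so V P can be its half. *)
Definition halves e q (V : bool -> nat -> nat -> R) : Prop :=
  [/\ pivotal e V, forall b k j, (j < k)%N -> V b k j = 0 &
   forall b k i, (k < K e)%N -> (i < K e)%N ->
    (\sum_(j < K e) V b k j * Pmat e q j i) *+ 2 = th (binomial (2 ^ e.+1)) b k i].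

Definition stable m e q V := forall s r, (s < m)%N -> (r < 2 ^ s)%N -> stab e q V s r.

Lemma complete e q V : halves e q V -> stable e.-1 e q V -> qok e.-1 q ->
  exists q', [/\ halves e q' V, stable e e q' V & qok e q'].
Proof.
case: e => [|e]; first by exists q.
move=> [pV V0 VP] sq qq.
have [i j jK|i j jK|C hC] := @extension e.+1 V (Pmat e.+1 q) isT pV _ _ VP.
- by move=> ji; rewrite /Pmat base_lower // mul0rn.
- by rewrite /Pmat size_mulrn_exp2; apply: size_base qq jK.
have e0 : (0 < 2 ^ e)%N by rewrite expn_gt0.
(* Only the residue of C modulo 2 matters, so its entry at [alpha] may be taken to be the exact
   polynomial of (ii). *)
pose q' i j := if (K e.+1 + 2 ^ e <= j < K e.+1 + 2 ^ e + 2 ^ e)%N then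
    (if i == alpha e (j - (K e.+1 + 2 ^ e)) then 'X^(2 ^ e) + 'X^(2 ^ e.+1)
     else C i (j - K e.+1)%N)
  else q i j.
have q'_old i j : (j < K e.+1)%N -> q' i j = q i j.
  by move=> jK; rewrite /q' leqNgt ltn_addr.
have q'_new i r : (r < 2 ^ e)%N -> q' i (K e.+1 + 2 ^ e + r)%N =
    if i == alpha e r then 'X^(2 ^ e) + 'X^(2 ^ e.+1) else C i (2 ^ e + r)%N.
  move=> hr; rewrite /q' leq_addr ltn_add2l hr addKn /=.
  by rewrite -addnA addKn.
have hE r : (r < 2 ^ e)%N -> (2 ^ e + r < 2 ^ e.+1)%N by rewrite expnS; lia.
have lastC r : (r < 2 ^ e)%N -> forall b k, (k < K e.+1)%N ->
    rd (\sum_(i < K e.+1) V b k i * C i (2 ^ e + r)%N)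
    = rd (xvar b) ^+ (2 ^ e.+2 - 1)%N *+ (k == 2 ^ e - 1 + r)%N.
  move=> hr b k kK; rewrite (hC _ (hE r hr)).2 // rd_th_col //; last 2 first.
  - by rewrite addn_gt0 e0.
  - by move=> m; apply: odd_bin_exp2.
  by congr (_ *+ (_ == _)); lia.
exists q'; split.
- split=> // b k i kK iK; rewrite -VP //; congr (_ *+ 2).
  by apply: eq_bigr => j _; rewrite /Pmat (eq_base _ q'_old).
- move=> s r; rewrite ltnS leq_eqVlt => /orP[/eqP ->|se] hr b k kK; last first.
    rewrite -sq //; congr (rd _); apply: eq_bigr => i _.
    by rewrite (@eq_qcol e.+1 q).
  have [ha hb h0] := @last_column e r V (fun i => C i (2 ^ e + r)%N) hr pV (lastC r hr).
  rewrite -lastC // !rmorph_sum; apply: eq_bigr => i _; rewrite !rmorphM /=.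
  congr (_ * _); rewrite /qcol q'_new //; case: (ltngtP (i : nat) (beta e r)) => bi.
  + case: eqP => [->|//].
    by rewrite ha rmorphD !rmorphXn /= map_polyX.
  + by rewrite rmorph0 h0.
  by rewrite bi hb rd_pgeom.
move=> s r; rewrite ltnS leq_eqVlt => /orP[/eqP ->|se] hr.
  split=> [|i ib]; first by rewrite q'_new // eqxx.
  rewrite q'_new //; case: eqP => [->|_].
    apply: leq_trans (size_polyD _ _) _; rewrite !size_polyXn geq_max.
    by rewrite /K /alpha !expnS; apply/andP; split; lia.
  rewrite -addnA; apply: (hC _ (hE r hr)).1.
  by apply: ltn_trans ib _; case: (alpha_beta_K hr (ltnSn e)).
have [h1 h2] := qq s r se hr.
have lt : (K s.+1 + 2 ^ s + r < K e.+1)%N.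
  have : (K s.+2 <= K e.+1)%N by rewrite leq_sub2r // leq_exp2l.
  by rewrite /K !expnS; have : (0 < 2 ^ s)%N by [rewrite expn_gt0]; lia.
by split=> [|i]; rewrite q'_old //; apply: h2.
Qed.

Lemma KS e : K e.+1 = (K e + 2 ^ e.+1)%N.
Proof. by have := K2 e; have := K2 e.+1; rewrite !expnS; lia. Qed.

Lemma qcol0 q s r i : (beta s r < i)%N -> qcol q s r i = 0.
Proof. by move=> bi; rewrite /qcol ltnNge (ltnW bi) (gtn_eqF bi). Qed.

Section Step.

Variables (e : nat) (q : nat -> nat -> R) (V X : bool -> nat -> nat -> R).
Variable c : nat -> nat.

Hypothesis pV : pivotal e V.
Hypothesis sV : stable e e q V.
Hypothesis X0 : forall b k j, (j < k)%N -> X b k j = 0.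
Hypothesis rX : forall b k j, (k < K e)%N -> (j < K e)%N -> rd (X b k j) = rd (V b k j).
Hypothesis XP : forall b k i, (k < K e)%N -> (i < K e)%N ->
  (\sum_(j < K e) X b k j * Pmat e q j i) *+ 2 = th c b k i.
Hypothesis c_low : forall m, (0 < m < 2 ^ e.+1)%N ->
  exists d, c m = (2 * d)%N /\ odd d = (m == 2 ^ e)%N.
Hypothesis c_odd : forall m, (0 < m <= K e.+1)%N -> odd (c m) = (m == 2 ^ e.+1)%N.

Let XC b k j := \sum_(i < K e) X b k i * base q i j.

(** For j = K_e + 2^s + r the column ends, apart from its diagonal entry, at row [beta s r], at most
    2^e - 2 + 2^s + r, while X is upper triangular. *)
Let XC0 b k j : (2 ^ e - 1 + j <= k + K e)%N -> (K e <= j < K e + 2 ^ e)%N -> XC b k j = 0.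
Proof.
move=> kj /andP[Kj jL]; rewrite /XC big1 // => i _.
have [ik|ki] := ltnP i k; first by rewrite X0 ?mul0r.
have iK := ltn_ord i; have [t [[r hr [rt Ej]]|[s [r [st hr Ej]]]]] := colP j.
  by rewrite Ej base_zero ?mulr0 // -Ej neq_ltn (leq_trans iK).
have ne : i != j :> nat by rewrite neq_ltn (leq_trans iK).
rewrite Ej base_new -?Ej //.
have te : t = e.
  have a0 : (0 < 2 ^ s)%N by rewrite expn_gt0.
  have := pow2_ltP st; rewrite expnS => a1.
  have := K2 e; have := K2 t => a2 a3.
  case: (ltngtP t e) => // /pow2_ltP; rewrite expnS => a4; exfalso; lia.
rewrite te in st Ej; have := pow2_ltP st; rewrite expnS => a1.
have bi : (beta s r < i)%N.
  have a0 : (0 < 2 ^ s)%N by rewrite expn_gt0.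
  by move: ki kj; rewrite Ej /beta; lia.
by rewrite ltnNge (ltnW bi) (gtn_eqF bi) mulr0.
Qed.

Let even_XC b k j : (K e <= j < K e + 2 ^ e)%N -> rd (th c b k j) = rd (XC b k j).
Proof.
move=> /andP[Kj jL]; have e0 : (0 < 2 ^ e)%N by rewrite expn_gt0.
have nE : (2 ^ e.+1 = 2 ^ e + 2 ^ e)%N by rewrite expnS mul2n addnn.
have k2 := K2 e.
have [jk|kj] := ltnP j k.
  by rewrite /th leqNgt jk rmorph0 /= XC0 ?rmorph0 ?Kj //; lia.
rewrite rd_th // c_odd; last by rewrite KS; lia.
have [kK|Kk] := ltnP k (K e); last first.
  rewrite XC0 ?rmorph0 ?Kj //; last by lia.
  by rewrite (_ : (_ == _) = false) //; apply/eqP; lia.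
have [t [[r hr [rt Ej]]|[s [r [st hr Ej]]]]] := colP j.
  have te : t = e.
    have := K2 t => a2; have := expnS 2 t => a5.
    case: (ltngtP t e) => // /pow2_ltP; rewrite expnS => a4; exfalso; lia.
  rewrite te in hr rt Ej; have {hr} r0 : r = 0%N by case: hr => [/eqP//|]; lia.
  rewrite /XC big1 ?rmorph0 => [|i _].
    by rewrite (_ : (_ == _) = false) //; apply/eqP; rewrite Ej r0; lia.
  rewrite Ej base_zero ?mulr0 //; first by left; rewrite r0.
  by rewrite neq_ltn (leq_trans (ltn_ord i)) // leq_addr.
have te : t = e.
  have a0 : (0 < 2 ^ s)%N by rewrite expn_gt0.
  have := pow2_ltP st; rewrite expnS => a1.
  have := K2 t => a2.
  case: (ltngtP t e) => // /pow2_ltP; rewrite expnS => a4; exfalso; lia.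
rewrite te in st Ej.
have := stab_base pV st hr (sV st hr) b kK; rewrite -Ej.
rewrite !rmorph_sum (eq_bigr (fun i : 'I__ => rd (X b k i * base q i j))); last first.
  by move=> i _; rewrite !rmorphM /= rX.
move=> ->; have -> : ((j - k).+1 == 2 ^ e.+1)%N = (k == 2 ^ s - 1 + r)%N.
  have a0 : (0 < 2 ^ s)%N by rewrite expn_gt0.
  by apply/eqP/eqP; rewrite Ej; lia.
case: eqP => [Ek|_]; last by rewrite !mulr0n.
have a0 : (0 < 2 ^ s)%N by rewrite expn_gt0.
by congr (_ ^+ _ *+ _); rewrite Ek Ej; lia.
Qed.

(** The equation Y P = [th c] is solved column by column: a middle column of P has diagonal entry 2,
    so by [even_XC] one can divide by 2, and a last column is a unit vector. The sequence c is left
    open because two are used: C(2^(e+2), m) / 2 in the induction and C(2^(e+1), m) at its end. *)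
Lemma step : exists Y : bool -> nat -> nat -> R,
  [/\ pivotal e.+1 Y, forall b k j, (j < k)%N -> Y b k j = 0,
      forall b k i, (k < K e.+1)%N -> (i < K e.+1)%N ->
        \sum_(j < K e.+1) Y b k j * Pmat e.+1 q j i = th c b k i &
      stable e e.+1 q Y].
Proof.
have e0 : (0 < 2 ^ e)%N by rewrite expn_gt0.
have nE : (2 ^ e.+1 = 2 ^ e + 2 ^ e)%N by rewrite expnS mul2n addnn.
have k2 := K2 e; have kS := KS e.
have /choice[H EH] : forall x : bool * nat * nat, exists w,
    (K e <= x.2 < K e + 2 ^ e)%N -> th c x.1.1 x.1.2 x.2 = XC x.1.1 x.1.2 x.2 + w *+ 2.
  move=> [[b k] j]; case: (boolP (K e <= j < K e + 2 ^ e)%N) => hj; last by exists 0.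
  by have [w ->] := rd_eq (even_XC b k hj); exists w.
pose Y b k j := if (j < K e)%N then X b k j
  else if (j < K e + 2 ^ e)%N then H (b, k, j) else th c b k j.
have Yold b k j : (j < K e)%N -> Y b k j = X b k j by rewrite /Y => ->.
have Ymid b k j : (K e <= j < K e + 2 ^ e)%N -> Y b k j = H (b, k, j).
  by move=> /andP[h1 h2]; rewrite /Y ltnNge h1 h2.
have Ynew b k j : (K e + 2 ^ e <= j)%N -> Y b k j = th c b k j.
  by move=> h; rewrite /Y ltnNge (leq_trans (leq_addr _ _) h) ltnNge h.
have Y0 b k j : (j < k)%N -> Y b k j = 0.
  move=> jk; have [jK|Kj] := ltnP j (K e); first by rewrite Yold ?X0.
  have [jL|Lj] := ltnP j (K e + 2 ^ e); last by rewrite Ynew // /th leqNgt jk.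
  have hj : (K e <= j < K e + 2 ^ e)%N by rewrite Kj.
  rewrite Ymid //; have := EH (b, k, j) hj; rewrite /= /th leqNgt jk XC0 //; last by lia.
  by rewrite add0r -[X in X = _](mul0rn _ 2) => /R_mulrn2_inj ->.
exists Y; split=> //.
- have XrK b k j : (j < K e)%N -> (K e <= k)%N -> rd (X b k j) = 0.
    by move=> jK Kk; rewrite X0 ?rmorph0 // (leq_trans jK).
  have [S1 S2 S3] := pV.
  have old_or j : (j < K e.+1)%N -> [\/ (j < K e)%N,
      exists2 r, (r < 2 ^ e)%N & j = alpha e r | exists2 r, (r < 2 ^ e)%N & j = beta e r].
    move=> jK; have [h|h] := ltnP j (K e); first by constructor 1.
    have [h'|h'] := ltnP j (K e + 2 ^ e).
      by constructor 2; exists (j - K e)%N; rewrite /alpha; rewrite /K in h h' k2 *; lia.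
    constructor 3; exists (j - (K e + 2 ^ e))%N; rewrite /beta; lia.
  have Yalpha b k r : (r < 2 ^ e)%N -> (2 ^ e - 1 + r <= k)%N ->
      rd (Y b k (alpha e r)) = rd (xvar b) ^+ (alpha e r - k) *+ (k == 2 ^ e - 1 + r)%N.
    move=> hr hk; have aE : alpha e r = (K e + r)%N by [].
    have hj : (K e <= alpha e r < K e + 2 ^ e)%N by rewrite aE leq_addr ltn_add2l.
    have := EH (b, k, alpha e r) hj; rewrite /= XC0 ?add0r //; last by rewrite aE; lia.
    rewrite Ymid // /th; case: leqP => kj; last first.
      rewrite -[X in X = _](mul0rn _ 2) => /R_mulrn2_inj <-; rewrite rmorph0.
      by rewrite gtn_eqF ?mulr0n // (leq_trans _ kj) // aE; lia.
    have [|d [-> od]] := @c_low (alpha e r - k).+1; first by rewrite aE in kj *; lia.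
    rewrite mulnC mulrnA => /R_mulrn2_inj <-; rewrite rd_mulrn od rmorphXn /=.
    by congr (_ *+ _); rewrite aE in kj *; apply/eqP/eqP; lia.
  have Ybeta b k r : (r < 2 ^ e)%N -> rd (Y b k (beta e r))
      = rd (xvar b) ^+ (beta e r - k) *+ (k == 2 ^ e - 1 + r)%N.
    move=> hr; have bE : beta e r = (K e + 2 ^ e + r)%N by rewrite /beta /K in k2 *; lia.
    rewrite Ynew; last by rewrite bE leq_addr.
    have [kj|jk] := leqP k (beta e r); last first.
      by rewrite /th leqNgt jk rmorph0 gtn_eqF // (leq_trans _ jk) // bE; lia.
    rewrite rd_th // c_odd; last by rewrite bE; lia.
    by congr (_ *+ _); rewrite bE in kj *; apply/eqP/eqP; lia.
  split=> [b k j|b j|b k j].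
  + move=> /old_or[jK|[r hr ->]|[r hr ->]].
    * rewrite Yold // => pk; have [kK|Kk] := ltnP k (K e); last exact: XrK.
      by rewrite rX // S1.
    * by rewrite (piv_alpha hr).1 => pk; rewrite Yalpha ?(ltnW pk) // (gtn_eqF pk).
    * by rewrite (piv_beta hr).1 => pk; rewrite Ybeta // (gtn_eqF pk).
  + move=> /old_or[jK|[r hr ->]|[r hr ->]].
    * rewrite Yold // rX //; first exact: S2.
      by have := piv_K jK; lia.
    * by rewrite (piv_alpha hr).1 Yalpha // eqxx.
    * by rewrite (piv_beta hr).1 Ybeta // eqxx.
  + move=> /old_or[jK|[r hr ->]|[r hr ->]].
    * rewrite Yold // => bj pk; have [kK|Kk] := ltnP k (K e); last exact: XrK.
      by rewrite rX // S3.
    * by rewrite (piv_alpha hr).2.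
    * by rewrite (piv_beta hr).1 => _ pk; rewrite Ybeta // (negbTE pk).
- move=> b k i kK iK; have [iKe|Kei] := ltnP i (K e).
    rewrite (@sum_ord_cut _ (K e) _ (fun j => Y b k j * Pmat e.+1 q j i)) //; last 2 first.
    + by rewrite kS leq_addr.
    + by move=> j /andP[Kj _]; rewrite /Pmat base_lower ?mul0rn ?mulr0 // (leq_trans iKe).
    have [kKe|Kek] := ltnP k (K e).
      rewrite -XP // -sumrMnl; apply: eq_bigr => j _; rewrite Yold // -mulrnAr.
      rewrite /Pmat -mulrnA -expnSr; congr (_ * (_ *+ 2 ^ _)).
      by have := lev_lt iKe; lia.
    have ik := leq_trans iKe Kek; rewrite /th leqNgt ik big1 // => j _.
    by rewrite Yold // X0 ?mul0r // (leq_trans _ Kek).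
  have hi : lev i = e.
    have [|<- _] := @lev_rhoK e (i - K e); first by lia.
    by congr lev; lia.
  have PE j : Pmat e.+1 q j i = base q j i by rewrite /Pmat hi subn1 subnn expn0.
  have iE : i = (K e + (i - K e))%N by lia.
  rewrite (@sum_ord_ext _ (K e) _ (fun j => Y b k j * Pmat e.+1 q j i) i); last 2 first.
  + by rewrite Kei.
  + move=> j /andP[Kj jK] ne; rewrite PE.
    have [t [[r hr [rt Ej]]|[s [r [st hr Ej]]]]] := colP i.
      by rewrite Ej base_zero ?mulr0 // -Ej.
    rewrite Ej base_new -?Ej //.
    have bj : (beta s r < j)%N.
      have te : t = e.
        by have := hi; rewrite Ej -addnA; have [|-> //] := @lev_rhoK t (2 ^ s + r);
          have := pow2_ltP st; rewrite !expnS; lia.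
      rewrite te in st; apply: leq_trans Kj.
      by case: (alpha_beta_K hr st).
    by rewrite ltnNge (ltnW bj) (gtn_eqF bj) mulr0.
  have dE : base q i i = if (i < K e + 2 ^ e)%N then 2 else 1.
    rewrite {1 2}iE base_diag; last by lia.
    by rewrite -[in RHS](subnKC Kei) ltn_add2l.
  rewrite PE dE (eq_bigr (fun j : 'I__ => X b k j * base q j i)); last first.
    by move=> j _; rewrite Yold // PE.
  case: ltnP => [iL|Li].
    have hj : (K e <= i < K e + 2 ^ e)%N by rewrite Kei.
    by rewrite Ymid // (EH (b, k, i) hj) mulr_natr.
  rewrite Ynew // mulr1 big1 ?add0r // => j _.
  rewrite iE base_zero ?mulr0 -?iE //; first by right; lia.
    by lia.
  by rewrite neq_ltn (leq_trans (ltn_ord j)).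
move=> s r se hr b k kK; have [_ bK] := alpha_beta_K hr se.
rewrite (@sum_ord_cut _ (K e) _ (fun j => Y b k j * qcol q s r j)); last 2 first.
- by rewrite kS leq_addr.
- by move=> j /andP[Kj _]; rewrite qcol0 ?mulr0 // (leq_trans bK).
have [kKe|Kek] := ltnP k (K e).
  rewrite -sV // !rmorph_sum; apply: eq_bigr => i _.
  by rewrite !rmorphM /= Yold // rX.
rewrite big1 ?rmorph0 => [|i _]; last by rewrite Yold // X0 ?mul0r // (leq_trans _ Kek).
have := alpha_beta_K hr se; rewrite gtn_eqF // (leq_trans _ Kek) //.
by have := pow2_ltP se; rewrite expnS; have : (0 < 2 ^ s)%N by [rewrite expn_gt0]; lia.
Qed.

End Step.

(** The coefficients of phi_(2n) / 2 = phi_n (1 + y t phi_n / 2). *)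
Lemma bin_double_half e M (n := (2 ^ e.+1)%N) : (0 < M < n)%N ->
  ('C(n, M) + \sum_(1 <= m < M) 'C(n, m) %/ 2 * 'C(n, M - m) = 'C(2 ^ e.+2, M) %/ 2)%N.
Proof.
move=> /andP[M0 Mn]; have n2 : (2 ^ e.+2 = n + n)%N by rewrite expnS mul2n addnn.
rewrite n2 -binomial.Vandermonde -(big_mkord xpredT (fun j => 'C(n, j) * 'C(n, M - j))%N).
rewrite big_nat_recr //= [in RHS]big_ltn // subn0 subnn !bin0 mul1n muln1.
rewrite addnAC addnn -muln2 divnMDl // big_nat [in RHS]big_nat.
congr (_ + _)%N; apply/esym.
rewrite (eq_bigr (fun m => 'C(n, m) %/ 2 * 'C(n, M - m) * 2)%N) => [|m /andP[m0 mM]].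
  by rewrite -big_distrl /= mulnK.
have [|d [-> _]] := @bin_half e m; first by rewrite m0 (ltn_trans mM).
by rewrite mulKn // [RHS]mulnC mulnA.
Qed.

Lemma next_halves e q V : halves e q V -> stable e e q V -> exists W,
  halves e.+1 q W /\ stable e e.+1 q W.
Proof.
move=> [pV V0 VP] sV; set n := (2 ^ e.+1)%N.
pose c m := ('C(2 ^ e.+2, m) %/ 2)%N.
(* This is (1 + y t phi_n / 2) V without the term m = n, whose coefficient is odd; row k + n of V
   vanishes on the columns below K_e. Modulo 2 only m = 2^e remains, and row k + 2^e lies below all
   pivots. *)
pose X b k j := V b k j + \sum_(1 <= m < n) xvar b ^+ m *+ ('C(n, m) %/ 2) * V b (k + m)%N j.
have n0 : (0 < n)%N by rewrite expn_gt0.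
have X0 b k j : (j < k)%N -> X b k j = 0.
  move=> jk; rewrite /X V0 // big1 ?addr0 // => m _.
  by rewrite V0 ?mulr0 // ltn_addr.
have rX b k j : (k < K e)%N -> (j < K e)%N -> rd (X b k j) = rd (V b k j).
  move=> kK jK; rewrite rmorphD [X in _ + X](_ : _ = 0) ?addr0 //.
  rewrite big_nat rmorph_sum big1 //= => m /andP[m0 mn]; rewrite rmorphM /=.
  have [E|ne] := eqVneq m (2 ^ e)%N.
    have [S1 _ _] := pV; rewrite S1 ?mulr0 // E.
    by have := piv_K jK; lia.
  have [|d [-> od]] := @bin_half e m; first by rewrite m0.
  by rewrite mulKn // rd_mulrn od (negbTE ne) mulr0n mul0r.
have [|||Y [pY Y0 YP sY]] := @step e q V X c pV sV X0 rX.
- move=> b k i kK iK; rewrite /X.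
  under eq_bigr => j _ do rewrite mulrDl mulr_suml.
  rewrite big_split /= mulrnDl VP // exchange_big /= -sumrMnl.
  rewrite (eq_big_nat _ _ (F2 := fun m => xvar b ^+ m *+ ('C(n, m) %/ 2)
      * th (binomial n) b (k + m) i)); last first.
    move=> m /andP[m0 mn].
    under eq_bigr => j _ do rewrite -mulrA.
    rewrite -mulr_sumr -mulrnAr; congr (_ * _).
    have [km|km] := ltnP (k + m) (K e); first by rewrite VP.
    rewrite big1 ?mul0rn => [|j _].
      by rewrite /th leqNgt (leq_trans iK).
    by rewrite V0 ?mul0r // (leq_trans _ km).
  have [ik|ki] := ltnP i k.
    rewrite /th [in LHS]leqNgt ik add0r leqNgt ik big1 // => m _.
    by rewrite leqNgt (ltn_addr _ ik) mulr0.
  set D := (i - k)%N; have Dn : (D.+1 < n)%N by rewrite /K -/n in iK kK *; lia.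
  rewrite (@big_cat_nat _ _ _ D.+1) //=; last by rewrite ltnW.
  rewrite [X in _ + (_ + X)]big_nat [X in _ + (_ + X)]big1 ?addr0; last first.
    by move=> m /andP[Dm mn]; rewrite /th leqNgt (_ : (i < k + m)%N) ?mulr0 //; lia.
  rewrite (eq_big_nat _ _ (F2 := fun m => xvar b ^+ D *+ ('C(n, m) %/ 2 * 'C(n, D.+1 - m)))).
    rewrite sumrMnr /th ki -/D -mulrnDr -/n; congr (_ *+ _).
    by rewrite bin_double_half.
  move=> m /andP[m0 mD]; rewrite /th (_ : (k + m <= i)%N); last by lia.
  rewrite mulrnAl mulrnAr -exprD -mulrnA mulnC (_ : (m + (i - (k + m)) = D)%N); last by lia.
  by congr (_ *+ (_ * 'C(_, _))); lia.
- move=> m hm; have [d [E od]] := bin_quarter hm.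
  by exists d; rewrite /c E mulKn.
- move=> m hm; have [|d [E od]] := @bin_half e.+1 m.
    by have := K2 e.+1; rewrite !expnS; lia.
  by rewrite /c E mulKn.
exists Y; split=> //; split=> // b k i kK iK; rewrite YP // /th.
case: leqP => ki; last by rewrite mul0rn.
rewrite -mulrnA; congr (_ *+ _); rewrite /c.
have [|d [-> _]] := @bin_half e.+1 (i - k).+1; last by rewrite mulKn // mulnC.
by have := K2 e.+1; rewrite !expnS; lia.
Qed.

Lemma halves_exist e : exists q V, [/\ halves e q V, stable e.-1 e q V & qok e.-1 q].
Proof.
elim: e => [|e [q [V [hV sV qq]]]].
  by exists (fun _ _ => 0), (fun _ _ _ => 0); split=> //; split.
have [q' [hV' sV' qq']] := complete hV sV qq.
by have [W [hW sW]] := next_halves hV' sV'; exists q', W.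
Qed.

Lemma reduction e : exists q V, [/\ qok e q, pivotal e.+1 V,
  forall b k j, (j < k)%N -> V b k j = 0 &
  forall b k i, (k < K e.+1)%N -> (i < K e.+1)%N ->
    \sum_(j < K e.+1) V b k j * Pmat e.+1 q j i = th (binomial (2 ^ e.+1)) b k i].
Proof.
have [q0 [V [hV sV qq]]] := halves_exist e.
have [q [[pV V0 VP] sV' qq']] := complete hV sV qq.
have [//||m hm|Y [pY Y0 YP _]] := step pV sV' V0 _ VP.
- exact: bin_half.
- by apply: odd_bin_exp2; case/andP: hm.
by exists q, Y.
Qed.

(** * Comparison with the prescribed entries *)

Lemma beta_shift s r t :
  (beta s r + 2 ^ s.+1 * (2 ^ t - 1) = K (s + t) + 2 ^ s + r)%N.
Proof.
have := K2 (s + t); rewrite expnD mulnBr muln1 /beta !expnS.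
have : (0 < 2 ^ s)%N by rewrite expn_gt0.
have : (2 ^ s <= 2 ^ s * 2 ^ t)%N by rewrite leq_pmulr // expn_gt0.
by rewrite -mulnA; lia.
Qed.

Lemma alpha_shift s r t :
  (alpha s r + 2 ^ s * (2 ^ t.+1 - 1) = K (s + t) + 2 ^ s + r)%N.
Proof.
have := K2 (s + t); rewrite expnD mulnBr muln1 /alpha !expnS.
have : (0 < 2 ^ s)%N by rewrite expn_gt0.
have : (2 ^ s <= 2 ^ s * 2 ^ t)%N by rewrite leq_pmulr // expn_gt0.
by rewrite mulnCA; lia.
Qed.

Lemma free_shift s r v :
  (K s.+1 + 2 ^ s + r + 2 ^ s.+2 * (2 ^ v - 1) = K (s.+1 + v) + 2 ^ s + r)%N.
Proof.
have := K2 (s.+1 + v); have := K2 s.+1; rewrite addSn !expnS expnD mulnBr muln1.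
have : (2 ^ s <= 2 ^ s * 2 ^ v)%N by rewrite leq_pmulr // expn_gt0.
by rewrite -!mulnA; lia.
Qed.

Lemma lev_new t s r : (s < t)%N -> (r < 2 ^ s)%N -> lev (K t + 2 ^ s + r) = t.
Proof.
move=> st hr; have [|E _] := @lev_rhoK t (2 ^ s + r); last by rewrite -addnA E.
by have := pow2_ltP st; rewrite !expnS; lia.
Qed.

Lemma geo_even (A : comNzRingType) m (x : A) :
  geo (2 * m) x = geo m (x ^+ 2) * (1 + x).
Proof.
have := geo_odd m x; rewrite /geo big_ord_recr /= -/(geo (2 * m) x).
by move/addIr.
Qed.

Lemma pgeom1 m : pgeom 1 m = 1.
Proof. by rewrite pgeomE /geo big_ord1 expr0. Qed.

Lemma exp2_mull n (p : R) : 2 ^+ n * p = p *+ 2 ^ n.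
Proof. by rewrite -natrX mulr_natl. Qed.

Lemma Pmat_specified e q i j v : (0 < e)%N -> qok e.-1 q -> (j < K e)%N ->
  specified e q i j v -> Pmat e q i j = v.
Proof.
move=> e0 hq jK hs; case: hs jK => {i j v}.
- move=> s i t se hi te jK.
  have a0 : (0 < 2 ^ s)%N by rewrite expn_gt0.
  have hr : (i - (3 * 2 ^ s - 2) < 2 ^ s)%N by lia.
  have Ei : i = beta s (i - (3 * 2 ^ s - 2)) by rewrite /beta; lia.
  move: hr Ei; move: (i - _)%N => r hr Ei; rewrite Ei.
  have [->|t0] := posnP t.
    rewrite muln0 addn0 subn0 pgeom1 mulr1 /Pmat.
    have Eb : beta s r = (K s + (2 ^ s + r))%N.
      by have := beta_shift s r 0; rewrite muln0 !addn0 => ->; rewrite addnA.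
    have h2 : (2 ^ s + r < 2 ^ s.+1)%N by rewrite expnS; lia.
    rewrite Eb base_diag // ltnNge leq_addr /= (lev_rhoK h2).1.
    by rewrite -[RHS]mulr1 exp2_mull.
  have st : (s < s + t)%N by lia.
  rewrite beta_shift /Pmat lev_new // base_new //; last first.
    by rewrite -beta_shift neq_ltn -[X in (X < _)%N]addn0 ltn_add2l muln_gt0 expn_gt0 subn_gt0
      -[1%N]/(2 ^ 0)%N ltn_exp2l // t0.
  by rewrite ltnn eqxx addKn exp2_mull subnDA.
- move=> s i se hi jK.
  have a0 : (0 < 2 ^ s)%N by rewrite expn_gt0.
  have hr : (i - (2 * 2 ^ s - 2) < 2 ^ s)%N by lia.
  have Ei : i = (K s + (i - (2 * 2 ^ s - 2)))%N by have := K2 s; lia.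
  move: hr Ei; move: (i - _)%N => r hr Ei; rewrite Ei /Pmat.
  have h2 : (r < 2 ^ s.+1)%N by rewrite expnS; lia.
  rewrite base_diag // hr (lev_rhoK h2).1 -exp2_mull -exprSr; congr (2 ^+ _); lia.
- move=> s i [|t] se hi ht jK //.
  have a0 : (0 < 2 ^ s)%N by rewrite expn_gt0.
  have hr : (i - (2 * 2 ^ s - 2) < 2 ^ s)%N by lia.
  have Ei : i = alpha s (i - (2 * 2 ^ s - 2)) by rewrite /alpha expnS; lia.
  move: hr Ei; move: (i - _)%N => r hr Ei; rewrite Ei.
  have st : (s < s + t)%N by lia.
  have sm : (s < e.-1)%N by lia.
  have [ab bK] := alpha_beta_K hr (ltnSn s).
  rewrite alpha_shift /Pmat lev_new // base_new //; last first.
    rewrite neq_ltn (ltn_trans ab) // (leq_trans bK) //.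
    suff : (K s.+1 <= K (s + t))%N by lia.
    by rewrite leq_sub2r // leq_exp2l // ltnS.
  rewrite ab addKn (hq s r sm hr).1 -mulrA exp2_mull; congr (_ *+ 2 ^ _); last by lia.
  have -> : (2 ^ t.+1 - 2 = 2 * (2 ^ t - 1))%N by rewrite expnS; lia.
  rewrite !pgeomE geo_even -exprM -expnSr; set Z := 'X^(2 ^ s).
  have -> : 'X^(2 ^ s.+1) = Z ^+ 2 :> R by rewrite -exprM -expnSr.
  by ring.
- move=> [|[|s]] i j; [by case/andP | by case/andP |].
  move=> ht hj hi jK; rewrite subSS subn1 /= in hj hi; rewrite !subSS subn0 in hj.
  have a0 : (0 < 2 ^ s)%N by rewrite expn_gt0.
  have k2 := K2 s.+1; rewrite !expnS in hj hi k2.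
  have hr : (j - (K s.+1 + 2 ^ s) < 2 ^ s)%N by lia.
  have Ej : j = (K s.+1 + 2 ^ s + (j - (K s.+1 + 2 ^ s)))%N by lia.
  move: hr Ej; move: (j - (_ + _))%N => r hr Ej.
  have ib : (i < beta s r)%N by rewrite /beta; lia.
  rewrite Ej /Pmat lev_new // base_new //; last by rewrite neq_ltn; apply/orP; left; lia.
  by rewrite ib subSnn pgeom1 mul1r exp2_mull; congr (_ *+ 2 ^ _); lia.
move=> [|[|s]] i j v; [by case/andP | by case/andP |].
move=> ht hj hi hv jK; rewrite subSS subn1 /= in hj hi; rewrite !subSS subn0 in hj.
have a0 : (0 < 2 ^ s)%N by rewrite expn_gt0.
have hj' := hj; have hi' := hi.
have k2 := K2 s.+1; rewrite !expnS in hj' hi' k2.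
have hr : (j - (K s.+1 + 2 ^ s) < 2 ^ s)%N by lia.
have Ej : j = (K s.+1 + 2 ^ s + (j - (K s.+1 + 2 ^ s)))%N by lia.
move: hr Ej; move: (j - (_ + _))%N => r hr Ej.
have ib : (i < beta s r)%N by rewrite /beta; lia.
have sv : (s < s.+1 + v)%N by lia.
have ne : i != (K (s.+1 + v) + 2 ^ s + r)%N.
  rewrite -free_shift neq_ltn; apply/orP; left; apply: ltn_addr.
  by move: ib k2; rewrite /beta; clear; lia.
rewrite Ej free_shift /Pmat lev_new // base_new //.
have E1 : (s.+1 + v - s = v.+1)%N by clear; lia.
have E2 : (e - 1 - (s.+1 + v) = e - s.+2 - v)%N by clear; lia.
by rewrite ib -mulrA exp2_mull E1 E2 subSS subn0.
Qed.

Lemma Pmat_unspecified e q i j : (i < K e)%N -> (j < K e)%N ->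
  (forall v, ~ specified e q i j v) -> Pmat e q i j = 0.
Proof.
move=> iK jK H; have [Eij|ne] := eqVneq i j.
  exfalso; have [s [r [hr _ Ei]]] := pivP i.
  have a0 : (0 < 2 ^ s)%N by rewrite expn_gt0.
  have se : (s < e)%N.
    rewrite ltnNge; apply/negP => es; have : (2 ^ e <= 2 ^ s)%N by rewrite leq_exp2l.
    by move: iK; have := K2 e; case: Ei => ->; rewrite /alpha /beta ?expnS; lia.
  case: Ei => Ei.
    apply: (H (2 ^+ (e - s))); rewrite -Eij Ei; apply: Spec_ii_diag; first by lia.
    by rewrite /alpha expnS; lia.
  have hi : (3 * 2 ^ s - 2 <= beta s r < 4 * 2 ^ s - 2)%N by rewrite /beta; lia.
  have hs : (s <= e - 1)%N by lia.
  have := @Spec_i e q s (beta s r) 0 hs hi (leq0n _).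
  by rewrite subnn muln0 addn0 -Ei {2}Eij; apply: H.
have [t [[r h [hr Ej]]|[s [r [st hr Ej]]]]] := colP j.
  by rewrite /Pmat Ej base_zero ?mul0rn // -Ej.
have te : (t < e)%N by rewrite -(lev_new st hr) -Ej lev_lt.
have a0 : (0 < 2 ^ s)%N by rewrite expn_gt0.
rewrite /Pmat [in base _ _ _]Ej base_new -?Ej //.
case: (ltngtP i (beta s r)) => [ib|bi|Ei]; last first.
- exfalso; apply: (H (2 ^+ (e - 1 - s - (t - s)) * pgeom (2 ^ (t - s).+1 - 1) (2 ^ s))).
  have -> : j = (i + 2 ^ s.+1 * (2 ^ (t - s) - 1))%N.
    by rewrite Ei beta_shift Ej subnKC // ltnW.
  by apply: Spec_i; rewrite ?Ei /beta; lia.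
- by rewrite mul0rn.
(* For s = 0 the only row above [beta] is row 0, which is [alpha] and belongs to (ii). For larger s
   the column is one of (iii), with t of (iii) equal to s + 2. *)
exfalso; case: s => [|s] in st hr Ej a0 ib *.
  have r0 : r = 0%N by case: r hr {Ej ib} => // r; rewrite expn0.
  have i0 : i = 0%N by move: ib; rewrite r0 /beta expn0; lia.
  apply: (H (2 ^+ (e - 0 - t.+1) * 'X^(2 ^ 0) * pgeom (2 ^ t.+1 - 2) (2 ^ 0))).
  have -> : j = (i + 2 ^ 0 * (2 ^ t.+1 - 1))%N.
    have := alpha_shift 0 0 t; rewrite add0n Ej r0 => <-.
    by rewrite i0 /alpha expn1 subnn.
  by apply: Spec_ii; rewrite ?i0 ?expn0; lia.
have EJ : (2 ^ (s.+3) = 2 * 2 ^ s.+2)%N by rewrite expnS.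
have EJ' : (2 ^ (s.+2) = 2 * 2 ^ s.+1)%N by rewrite expnS.
have kk := K2 s.+2.
set j0 := (K s.+2 + 2 ^ s.+1 + r)%N.
have hj0 : (2 ^ s.+3 + 2 ^ (s.+3 - 2) - 2 <= j0 <= 2 ^ s.+3 + 2 ^ (s.+3 - 1) - 3)%N.
  by rewrite !subSS !subn0 /j0; lia.
have hi0 : (i < j0 - 2 ^ (s.+3 - 1))%N.
  by rewrite subSS subn0 /j0; move: ib; rewrite /beta; lia.
have [Et|lt] := eqVneq t s.+2.
  apply: (H (2 ^+ (e - s.+3) * q i j0)); rewrite Ej Et.
  by apply: Spec_iii => //; lia.
have := @Spec_iii_v e q s.+3 i j0 (t - s.+2) _ hj0 hi0.
rewrite free_shift subnKC; last by lia.
by rewrite -Ej => /(_ ltac:(lia) ltac:(lia)); apply: H.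
Qed.

(** * Presentations of G_d *)

Section Toeplitz.

Variable d : nat.

Definition tz (p : R) (r c : nat) : Z2loc := if (c <= r)%N then p`_(r - c) else 0.

Lemma tzD p q r c : tz (p + q) r c = tz p r c + tz q r c.
Proof. by rewrite /tz coefD; case: ifP; rewrite ?addr0. Qed.

Lemma tz0 r c : tz 0 r c = 0.
Proof. by rewrite /tz coef0 if_same. Qed.

Lemma tz_sum (I : Type) (s : seq I) (F : I -> R) r c :
  tz (\sum_(i <- s) F i) r c = \sum_(i <- s) tz (F i) r c.
Proof.
elim: s => [|i s IH]; last by rewrite !big_cons tzD IH.
by rewrite !big_nil /tz coef0 if_same.
Qed.

(** Because of the degree bound on q, column c of its Toeplitz matrix ends before row n, so
    truncating to n rows loses nothing. This is what the degree bounds on P serve for. *)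
Lemma tzM (p q : R) n l r c : (l <= n)%N -> (c < l)%N -> (size q <= (n - l).+1)%N ->
  \sum_(t < n) tz p r t * tz q t c = tz (p * q) r c.
Proof.
move=> ln cl sq; pose g t := tz p r t * tz q t c.
have g_big t : (r < t)%N -> g t = 0 by move=> rt; rewrite /g /tz leqNgt rt mul0r.
rewrite -(@sum_ord_cut _ n (n + r.+1) g) ?leq_addr //; last first.
  move=> t /andP[nt _]; rewrite /g [tz q _ _]/tz; case: ifP => ct; last by rewrite mulr0.
  by rewrite nth_default ?mulr0 // (leq_trans sq) //; lia.
rewrite (@sum_ord_cut _ r.+1 (n + r.+1) g) ?leq_addl //; last first.
  by move=> t /andP[rt _]; apply: g_big.
rewrite /tz; case: leqP => cr; last first.
  rewrite big1 // => t _; rewrite /g [tz q _ _]/tz leqNgt.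
  by rewrite (leq_ltn_trans _ cr) ?mulr0 // -ltnS.
rewrite coefMr -(big_mkord xpredT g) (@big_cat_nat _ _ _ c) //=; last by rewrite leqW.
rewrite [X in X + _]big_nat big1 ?add0r => [|t /andP[_ tc]]; last first.
  by rewrite /g [tz q _ _]/tz leqNgt tc mulr0.
rewrite -[X in \sum_(X <= _ < _) _]add0n big_addn subSn // big_mkord.
apply: eq_bigr => t _; rewrite /g /tz leq_addl addnK.
rewrite (_ : (t + c <= r)%N); last by have := ltn_ord t; lia.
by rewrite subnDA subnAC.
Qed.

Definition Tm (F : nat -> nat -> R) :
    'M[Z2loc]_(\sum_(i < d.+1) (d.+1 - i), \sum_(j < d.+1) (d.+1 - j)) :=
  \mxblock_(i < d.+1, j < d.+1) toeplitz (d.+1 - i) (d.+1 - j) (F i j).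

Lemma TmM (F G : nat -> nat -> R) :
  (forall k j, (j <= d)%N -> (j < k)%N -> G k j = 0) ->
  (forall k j, (j <= d)%N -> (size (G k j) <= (j - k).+1)%N) ->
  Tm F *m Tm G = Tm (fun i j => \sum_(k < d.+1) F i k * G k j).
Proof.
move=> G0 sG; rewrite /Tm mul_mxblock; apply: eq_mxblock => i j.
apply/matrixP=> r c; rewrite summxE [RHS]mxE -/(tz _ r c) tz_sum.
apply: eq_bigr => k _; rewrite mxE.
under eq_bigr => t _ do rewrite !mxE -/(tz _ r t) -/(tz _ t c).
have jd : (j <= d)%N by rewrite -ltnS.
have [kj|jk] := leqP k j.
  apply: (@tzM _ _ _ (d.+1 - j)); [lia | exact: ltn_ord |].
  by apply: leq_trans (sG k j jd) _; have := ltn_ord k; lia.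
by rewrite G0 // mulr0 tz0 big1 // => t _; rewrite tz0 mulr0.
Qed.

Definition vec (F : nat -> nat -> Z2loc) : 'rV[Z2loc]_(\sum_(j < d.+1) (d.+1 - j)) :=
  \mxrow_(j < d.+1) \row_(k < d.+1 - j) F j k.

Lemma eq_vec F F' : (forall j k, (j + k <= d)%N -> F j k = F' j k) -> vec F = vec F'.
Proof.
move=> h; apply: eq_mxrow => j; apply/rowP=> k; rewrite !mxE; apply: h.
by have := ltn_ord j; have := ltn_ord k; lia.
Qed.

Lemma submxrow_vec F (j : 'I_d.+1) k : submxrow (vec F) j 0 k = F j k.
Proof. by rewrite /vec mxrowK mxE. Qed.

Lemma vecP (c : 'rV[Z2loc]_(\sum_(j < d.+1) (d.+1 - j))) : exists F, c = vec F.
Proof.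
exists (fun j k => if (insub j : option 'I_d.+1) is Some j' then
   if (insub k : option 'I_(d.+1 - j')) is Some k' then submxrow c j' 0 k'
   else 0 else 0).
rewrite -[LHS]submxrowK; apply: eq_mxrow => j; apply/rowP=> k; rewrite [RHS]mxE.
by rewrite (valK j) (valK k).
Qed.

Lemma vecD F G : vec F + vec G = vec (fun j k => F j k + G j k).
Proof.
by rewrite /vec -mxrowD; apply: eq_mxrow => j; apply/rowP=> k; rewrite !mxE.
Qed.

Lemma vec_Tm F V : vec F *m Tm V
  = vec (fun j c => \sum_(i < d.+1) \sum_(r < d.+1 - i) F i r * tz (V i j) r c).
Proof.
rewrite /vec /Tm mul_mxrow_mxblock; apply: eq_mxrow => j; apply/rowP=> c.
rewrite summxE [RHS]mxE; apply: eq_bigr => i _; rewrite mxE.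
by apply: eq_bigr => r _; rewrite !mxE.
Qed.

End Toeplitz.

(** * Generation by the rows of V *)

Section Generation.

Variables (e d : nat) (V : bool -> nat -> nat -> R).
Hypothesis dK : (d < K e)%N.
Hypothesis pV : pivotal e V.

Let Im2 (F : nat -> nat -> Z2loc) := exists a b z,
  vec d F = a *m Tm d (V false) + b *m Tm d (V true) + z *+ 2.

Let Im2B F G : Im2 F -> Im2 G -> Im2 (fun j c => F j c - G j c).
Proof.
move=> [a [b [z E]]] [a' [b' [z' E']]]; exists (a - a'), (b - b'), (z - z').
have -> : vec d (fun j c => F j c - G j c) = vec d F - vec d G.
  by apply/eqP; rewrite eq_sym subr_eq vecD; apply/eqP/eq_vec => j k _; rewrite subrK.
by rewrite E E' !mulmxBl mulrnBl !opprD [X in _ = X + _]addrACA [RHS]addrACA.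
Qed.

Let Im2_eq F G : (forall j c, (j + c <= d)%N -> F j c = G j c) -> Im2 G -> Im2 F.
Proof. by rewrite /Im2 => /eq_vec ->. Qed.

Let Im2_double F : Im2 (fun j c => F j c *+ 2).
Proof.
exists 0, 0, (vec d F); rewrite !mul0mx !add0r mulr2n vecD.
by apply: eq_vec => j c _; rewrite mulr2n.
Qed.

Let Im2_0 : Im2 (fun _ _ => 0).
Proof. by apply: (Im2_eq (G := fun _ _ => 0 *+ 2)) (Im2_double _) => *; rewrite mul0rn. Qed.

Let Im2N F : Im2 F -> Im2 (fun j c => - F j c).
Proof. by move=> h; apply: Im2_eq (Im2B Im2_0 h) => *; rewrite sub0r. Qed.

Let Im2D F G : Im2 F -> Im2 G -> Im2 (fun j c => F j c + G j c).
Proof. by move=> h /Im2N h'; apply: Im2_eq (Im2B h h') => *; rewrite opprK. Qed.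

Let Im2_sum (I : Type) (s : seq I) (P : pred I) F : (forall i, P i -> Im2 (F i)) ->
  Im2 (fun j c => \sum_(i <- s | P i) F i j c).
Proof.
move=> h; elim: s => [|i s IH].
  by apply: Im2_eq Im2_0 => *; rewrite big_nil.
have [Pi|nPi] := boolP (P i).
  by apply: Im2_eq (Im2D (h i Pi) IH) => *; rewrite big_cons Pi.
by apply: Im2_eq IH => *; rewrite big_cons (negbTE nPi).
Qed.

Definition emb (j : nat) (u : nat -> Z2loc) (j' c : nat) : Z2loc := if j' == j then u c else 0.

Lemma Z2loc_even_coef (p : R) t : rd p = 0 -> exists w, p`_t = w *+ 2.
Proof. by move=> /rd_eq0[w ->]; exists w`_t; rewrite coefMn. Qed.

Lemma tz_rd0 p r c : rd p = 0 -> exists w, tz p r c = w *+ 2.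
Proof.
by rewrite /tz; case: ifP => _; [exact: Z2loc_even_coef | exists 0; rewrite mul0rn].
Qed.

Let blk b k (u : nat -> Z2loc) j c := \sum_(r < d.+1 - k) u r * tz (V b k j) r c.

Let Im2_blk b k u : (k <= d)%N -> Im2 (blk b k u).
Proof.
move=> kd; have E : vec d (blk b k u) = vec d (emb k u) *m Tm d (V b).
  rewrite vec_Tm; apply: eq_vec => j c _; have kd' : (k < d.+1)%N by [].
  rewrite (bigD1 (Ordinal kd')) //= [X in _ + X]big1 ?addr0 => [|i].
    by apply: eq_bigr => r _; rewrite /emb eqxx.
  rewrite -val_eqE /= => ne; rewrite big1 // => r _.
  by rewrite /emb (negbTE ne) mul0r.
case: b E => E; [exists 0, (vec d (emb k u)), 0 | exists (vec d (emb k u)), 0, 0].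
  by rewrite E mul0mx add0r mul0rn addr0.
by rewrite E mul0mx addr0 mul0rn addr0.
Qed.

Let blk_even b k u j : rd (V b k j) = 0 -> exists w, forall c, blk b k u j c = w c *+ 2.
Proof.
move=> h; have /choice[f Ef] : forall rc : nat * nat, exists w,
    tz (V b k j) rc.1 rc.2 = w *+ 2 by move=> rc; apply: tz_rd0.
exists (fun c => \sum_(r < d.+1 - k) u r * f (r : nat, c)) => c.
by rewrite -sumrMnl; apply: eq_bigr => r _; rewrite (Ef (r : nat, c)) mulrnAr.
Qed.

Let blk_pivot b k u j : (k <= j)%N -> rd (V b k j) = rd (xvar b) ^+ (j - k) ->
  exists w, forall c, (j + c <= d)%N ->
    blk b k u j c = u (c + b * (j - k))%N + w c *+ 2.
Proof.
move=> kj h; have [|v Ev] := @rd_eq (V b k j) (xvar b ^+ (j - k)).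
  by rewrite rmorphXn.
exists (fun c => \sum_(r < d.+1 - k) u r * tz v r c) => c hc.
have -> : blk b k u j c = \sum_(r < d.+1 - k) u r * tz (xvar b ^+ (j - k)) r c
    + \sum_(r < d.+1 - k) u r * tz (v *+ 2) r c.
  by rewrite -big_split; apply: eq_bigr => r _; rewrite /= -mulrDr -tzD -Ev.
congr (_ + _); last first.
  rewrite -sumrMnl; apply: eq_bigr => r _; rewrite -mulrnAr; congr (_ * _).
  by rewrite /tz; case: ifP => _; rewrite ?coefMn ?mul0rn.
have hm : (c + b * (j - k) < d.+1 - k)%N by case: b {h Ev} => /=; lia.
rewrite (bigD1 (Ordinal hm)) //= big1 ?addr0 => [|r].
  by rewrite /tz leq_addr addKn; case: b {h Ev hm}; rewrite /= ?mul1n ?coefXn ?eqxx ?mulr1 //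
    mul0n expr1n coef1 mulr1.
rewrite -val_eqE /= /tz; case: leqP => [cr ne|_ _]; last by rewrite mulr0.
case: b {h Ev hm} ne => /= ne; rewrite ?coefXn ?expr1n ?coef1.
  by rewrite (_ : (_ == _) = false) ?mulr0 //; apply/negbTE; apply: contra ne => /eqP; lia.
by rewrite (_ : (_ == _) = false) ?mulr0 //; apply/negbTE; apply: contra ne => /eqP; lia.
Qed.

Let Im2_emb_even j w : Im2 (emb j (fun c => w c *+ 2)).
Proof.
apply: Im2_eq (Im2_double (emb j w)) => j' c _.
by rewrite /emb; case: ifP => _; rewrite ?mul0rn.
Qed.

(** A combination u of the rows in block k of V_b is, up to doubles, supported on blocks with pivot
    at least k. Those with a larger pivot are already in the span, and in the two blocks with pivot
    k it is u, shifted by j - k if b is true. *)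
Let pivot_gen s r (b : bool) u (k := (2 ^ s - 1 + r)%N) : (s < e)%N -> (r < 2 ^ s)%N ->
  (forall j, (j < K e)%N -> (k < piv j)%N -> forall u, Im2 (emb j u)) ->
  Im2 (fun j c => if (j == alpha s r) || (j == beta s r) then u (c + b * (j - k))%N else 0).
Proof.
move=> se hr IH; have [S1 S2 _] := pV.
have s0 : (0 < 2 ^ s)%N by rewrite expn_gt0.
have [ab bK] := alpha_beta_K hr se.
have ka : (k <= alpha s r)%N by rewrite /k /alpha expnS; lia.
have [kd|dk] := leqP k d; last first.
  apply: Im2_eq Im2_0 => j c h; case: ifP => // /orP[]/eqP Ej; exfalso; lia.
pose rest j c := if (j == alpha s r) || (j == beta s r) then 0 else blk b k u j c.
have Irest : Im2 rest.
  apply: (Im2_eq (G := fun j c => \sum_(i < d.+1) emb i (rest i) j c)).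
    move=> j c h; have jd : (j < d.+1)%N by lia.
    rewrite (bigD1 (Ordinal jd)) //= /emb eqxx big1 ?addr0 // => i.
    by rewrite -val_eqE /= eq_sym => /negbTE ->.
  apply: Im2_sum => i _; have iK : (i < K e)%N by apply: leq_trans (ltn_ord i) dK.
  have [lt|gt|Ei] := ltngtP (piv i) k; last first.
  - apply: Im2_eq Im2_0 => j c _; rewrite /emb /rest.
    by have [->|->] := piv_eq hr Ei; rewrite eqxx ?orbT if_same.
  - exact: IH.
  have [w Ew] := blk_even u (S1 b k i iK lt).
  apply: (Im2_eq (G := emb i (fun c => (if (i == alpha s r :> nat) || (i == beta s r :> nat)
     then 0 else w c) *+ 2))) (Im2_emb_even _ _) => j c _.
  by rewrite /emb /rest; case: ifP => // _; case: ifP => _; rewrite ?Ew ?mul0rn.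
have pa : rd (V b k (alpha s r)) = rd (xvar b) ^+ (alpha s r - k).
  by have := S2 b _ (ltn_trans ab bK); rewrite (piv_alpha hr).1.
have pb : rd (V b k (beta s r)) = rd (xvar b) ^+ (beta s r - k).
  by have := S2 b _ bK; rewrite (piv_beta hr).1.
have [wa Ea] := blk_pivot u ka pa.
have [wb Eb] := blk_pivot u (leq_trans ka (ltnW ab)) pb.
apply: Im2_eq (Im2B (Im2B (Im2B (Im2_blk b u kd) Irest)
   (Im2_emb_even (alpha s r) wa)) (Im2_emb_even (beta s r) wb)) => j c h.
rewrite /rest /emb; have [Ej|na] := eqVneq j (alpha s r).
  by rewrite Ej (ltn_eqF ab) /= Ea -?Ej // !subr0 addrK.
have [Ej|nb] := eqVneq j (beta s r); last by rewrite /= subrr !subr0.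
by rewrite Ej /= Eb -?Ej // !subr0 addrK.
Qed.

Let Im2_emb j u : (j < K e)%N -> Im2 (emb j u).
Proof.
suff H m : forall j, (j < K e)%N -> (2 ^ e - 1 - m <= piv j)%N ->
    forall u, Im2 (emb j u).
  by move=> jK; apply: (H (2 ^ e - 1)%N j) => //; rewrite subnn.
elim: m => [|m IH] {u}{}j jK mj; first by have := piv_K jK; lia.
have [lt|ge] := ltnP (2 ^ e - 1 - m.+1)%N (piv j); first by apply: IH => //; lia.
have pj := piv_K jK; have [s [r [se hr Ek]]] := row_pivot pj.
have s0 : (0 < 2 ^ s)%N by rewrite expn_gt0.
have ht j' : (j' < K e)%N -> (2 ^ s - 1 + r < piv j')%N -> forall u, Im2 (emb j' u).
  by move=> j'K lt; apply: IH => //; lia.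
have [ab _] := alpha_beta_K hr se.
have gen b u := pivot_gen b u se hr ht.
have Ib u : Im2 (emb (beta s r) u).
  (* v solves the telescoping equation v(c) - v(c + 2^s) = u(c) for c <= d.      *)
  pose u' c := if (c <= d)%N then u c else 0.
  pose v c := \sum_(i < d.+1) u' (c + i * 2 ^ s)%N.
  have Ev c : (c <= d)%N -> v c - v (c + 2 ^ s)%N = u c.
    move=> cd; rewrite /v big_ord_recl [X in _ - X]big_ord_recr /= mul0n addn0.
    have -> : u' c = u c by rewrite /u' cd.
    have -> : u' (c + 2 ^ s + d * 2 ^ s)%N = 0.
      by rewrite /u' leqNgt (_ : (d < _)%N) //; have := leq_pmulr d s0; lia.
    rewrite addr0; apply/eqP; rewrite subr_eq; apply/eqP; congr (_ + _).
    by apply: eq_bigr => i _; congr u'; rewrite /bump /= add1n mulSn addnA.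
  (* The shift by 2^s - 1 makes the two combinations agree in block [alpha]; in block [beta] they
     differ by a relative shift of 2^s. *)
  apply: Im2_eq (Im2B (gen false v) (gen true (fun t => v (t - (2 ^ s - 1))%N))) => j' c h.
  rewrite /emb; have [->|na] := eqVneq j' (alpha s r).
    rewrite (ltn_eqF ab) /= mul0n mul1n addn0.
    rewrite (_ : c + _ - _ = c)%N ?subrr //; rewrite /alpha expnS; lia.
  have [->|nb] := eqVneq j' (beta s r); last by rewrite /= subr0.
  rewrite /= mul0n mul1n addn0.
  rewrite (_ : (c + (beta s r - (2 ^ s - 1 + r)) - (2 ^ s - 1) = c + 2 ^ s)%N).
    by rewrite Ev //; lia.
  by rewrite /beta; lia.
move=> u; have [->|->] := piv_eq hr Ek; last exact: Ib.
apply: Im2_eq (Im2B (gen false u) (Ib u)) => j' c _; rewrite /emb.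
have [->|na] := eqVneq j' (alpha s r).
  by rewrite (ltn_eqF ab) /= mul0n addn0 subr0.
by case: eqVneq => _ /=; rewrite ?mul0n ?addn0 subrr.
Qed.

Let Im2_all F : Im2 F.
Proof.
apply: (Im2_eq (G := fun j c => \sum_(i < d.+1) emb i (F i) j c)).
  move=> j c h; have jd : (j < d.+1)%N by lia.
  rewrite (bigD1 (Ordinal jd)) //= /emb eqxx big1 ?addr0 // => i.
  by rewrite -val_eqE /= eq_sym => /negbTE ->.
by apply: Im2_sum => i _; apply: Im2_emb; apply: leq_trans (ltn_ord i) dK.
Qed.

(* Nakayama's lemma: [1 - 2 Z] is invertible, its determinant being odd.       *)
Lemma pivotal_gen : exists A B,
  A *m Tm d (V false) + B *m Tm d (V true) = 1%:M.
Proof.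
set T0 := Tm d (V false); set T1 := Tm d (V true).
have /choice[f Ef] : forall i, exists abz : 'rV_ _ * 'rV_ _ * 'rV_ _,
    row i 1%:M = abz.1.1 *m T0 + abz.1.2 *m T1 + abz.2 *+ 2.
  move=> i; have [F ->] := vecP (matrix.row i (1%:M : 'M[Z2loc]_(\sum_(j < d.+1) (d.+1 - j)))).
  by have [a [b [z E]]] := Im2_all F; exists (a, b, z).
pose A := \matrix_i (f i).1.1; pose B := \matrix_i (f i).1.2; pose Z := \matrix_i (f i).2.
have E1 : 1%:M = A *m T0 + B *m T1 + Z *+ 2.
  apply/row_matrixP=> i; by rewrite [LHS]Ef !linearD /= !row_mul !rowK.
have ED : 1%:M - Z *+ 2 = A *m T0 + B *m T1 by rewrite E1 addrK.
have [w Ew] : exists w, w * \det (1%:M - Z *+ 2) = 1.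
  apply: redz_unit; rewrite -det_map_mx rmorphB /= map_mx1.
  have -> : map_mx redz (Z *+ 2) = 0.
    by rewrite raddfMn /= -scaler_nat (pchar_Zp (isT : 1 < 2)%N) scale0r.
  by rewrite subr0 det1 oner_eq0.
pose W := w *: \adj (1%:M - Z *+ 2).
exists (W *m A), (W *m B); rewrite -!mulmxA -mulmxDr -ED /W -scalemxAl mul_adj_mx.
by rewrite scale_scalar_mx Ew.
Qed.

End Generation.

(** * The relations of G_d as a row span *)

Section Relations.

Variables (e d : nat).
Let n := (2 ^ e)%N.

Definition relr (b : bool) := if b then rel1 e else rel2 e.

Definition hit (b : bool) i j p q :=
  if b then (q == j) && (p <= i)%N else (p == i) && (q <= j)%N.

Lemma coef_relr b i j p q : (relr b i j)@_(p, q)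
  = if hit b i j p q then 'C(n, (i + j - (p + q)).+1)%:R * 'X^(i + j - (p + q)) else 0.
Proof.
have main (k m : nat) (x : nat -> nat * nat) : (forall l, (l < k.+1)%N ->
      (x l == (p, q)) = (l == m)) ->
    (\sum_(l < k.+1) ('C(n, l.+1)%:R * 'X^l) *: << x l >> : free_ku)@_(p, q)
    = if (m < k.+1)%N then 'C(n, m.+1)%:R * 'X^m else 0.
  move=> hx; rewrite raddf_sum /=.
  rewrite (eq_bigr (fun l : 'I_k.+1 => if l == m :> nat then
     'C(n, l.+1)%:R * 'X^l else 0)) => [|l _]; last first.
    by rewrite mcoeffZ mcoeffU hx //; case: eqP => _; rewrite ?mulr1 ?mulr0.
  case: ltnP => mk; last first.
    rewrite big1 // => l _; rewrite ltn_eqF //; exact: leq_trans (ltn_ord l) mk.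
  rewrite (bigD1 (Ordinal mk)) //= eqxx big1 ?addr0 // => l.
  by rewrite -val_eqE /= => /negbTE ->.
have oops (k : nat) (x : nat -> nat * nat) :
    (forall l, (l < k.+1)%N -> (x l == (p, q)) = false) ->
    (\sum_(l < k.+1) ('C(n, l.+1)%:R * 'X^l) *: << x l >> : free_ku)@_(p, q) = 0.
  move=> hx; rewrite raddf_sum /= big1 // => l _.
  by rewrite mcoeffZ mcoeffU hx // mulr0.
case: b; rewrite /relr /hit /rel1 /rel2.
  case: (boolP ((q == j) && (p <= i)%N)) => [/andP[/eqP Eq pi]|no].
    apply: etrans (@main i (i - p)%N (fun l => (i - l, j)%N) _) _ => [l li|].
      by rewrite xpair_eqE Eq eqxx andbT; apply/eqP/eqP; lia.
    by rewrite ltnS leq_subr Eq subnDr.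
  apply: (@oops i (fun l => (i - l, j)%N)) => l li.
  by apply: contraNF no; rewrite xpair_eqE => /andP[/eqP <- /eqP ->]; rewrite eqxx leq_subr.
case: (boolP ((p == i) && (q <= j)%N)) => [/andP[/eqP Eq pi]|no].
  apply: etrans (@main j (j - q)%N (fun l => (i, j - l)%N) _) _ => [l li|].
    by rewrite xpair_eqE Eq eqxx /=; apply/eqP/eqP; lia.
  by rewrite ltnS leq_subr Eq subnDl.
apply: (@oops j (fun l => (i, j - l)%N)) => l li.
by apply: contraNF no; rewrite xpair_eqE => /andP[/eqP -> /eqP <-]; rewrite eqxx leq_subr.
Qed.

(** Row i of block d - i - j is the relation at (i, j) times u^(d-i-j), and column p of block d - p
    - q is the generator u^(d-p-q)[p,q]. *)
Lemma tz_th b i j p q : (i + j <= d)%N -> (p + q <= d)%N ->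
  tz (th (binomial n) b (d - i - j) (d - p - q)) i p
  = if hit b i j p q then 'C(n, (i + j - (p + q)).+1)%:R else 0.
Proof.
move=> hij hpq; rewrite /tz /th /hit.
have E : (d - i - j <= d - p - q)%N -> (d - p - q - (d - i - j) = i + j - (p + q))%N by lia.
case: b; rewrite /xvar.
  case: (leqP p i) => pi; last by rewrite andbF.
  rewrite andbT; case: ifP => le.
    rewrite E // coefMn coefXn; have [->|ne] := eqVneq q j.
      by rewrite subnDr eqxx.
    by rewrite (_ : (_ == _) = false) ?mul0rn //; apply/negbTE; apply: contra ne => /eqP; lia.
  by rewrite coef0 (_ : (q == j) = false) //; apply/negbTE; apply: contraFN le => /eqP; lia.
case: (leqP p i) => pi; last by rewrite gtn_eqF.
case: ifP => le.
  rewrite E // expr1n coefMn coef1; have [Ep|ne] := eqVneq p i.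
    by rewrite Ep subnn eqxx (_ : (q <= j)%N) //; lia.
  by rewrite (_ : (_ == _) = false) ?mul0rn //; apply/negbTE; apply: contra ne => /eqP; lia.
by rewrite coef0; case: eqP => //= Ep; rewrite ifF //; apply/negbTE; lia.
Qed.

Definition hom (F : nat -> nat -> Z2loc) : free_ku :=
  \sum_(j < d.+1) \sum_(k < d.+1 - j) ((F j k)%:P * 'X^j) *: << (k : nat, (d - j - k)%N) >>.

Lemma relation_hom F : relation e (vec d F) <-> hom F \in relators e.
Proof.
rewrite /relation (eq_bigr (fun j : 'I_d.+1 => \sum_(k < d.+1 - j) (F j k)%:P *: gen e d j k)).
  rewrite gen_comb -/(hom F) -[X in _ = X](linear0 (cl e)) cl_eq subr0.
  by [].
by move=> j _; apply: eq_bigr => k _; rewrite submxrow_vec.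
Qed.

Let Phi b := Tm d (th (binomial n) b).

Let Sp (c : 'rV[Z2loc]_(\sum_(j < d.+1) (d.+1 - j))) :=
  exists a b, c = a *m Phi false + b *m Phi true.

Lemma relr_relators b i j : relr b i j \in relators e.
Proof.
apply/asboolP; case: b; [exists [:: (1, (i, j))], [::] | exists [::], [:: (1, (i, j))]];
  by rewrite /ku_comb !big_cons !big_nil /= scale1r ?addr0 ?add0r.
Qed.

Lemma hom_Phi b A : exists2 f, f \in relators e &
  exists2 F, vec d A *m Phi b = vec d F & hom F = f.
Proof.
exists (\sum_(i < d.+1) \sum_(r < d.+1 - i)
    ((A i r)%:P * 'X^i) *: relr b r (d - i - r)).
  apply: rpred_sum => i _; apply: rpred_sum => r _.
  by apply: relatorsZ; apply: relr_relators.
eexists; first exact: vec_Tm.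
apply/malgP => -[p q]; rewrite coef_gen_comb raddf_sum /=.
under [RHS]eq_bigr do rewrite raddf_sum /=.
case: ifP => hpq.
  rewrite scaler_suml; apply: eq_bigr => i _; rewrite scaler_suml; apply: eq_bigr => r _.
  have ir : (i + r <= d)%N by have := ltn_ord i; have := ltn_ord r; lia.
  have hr : (r + (d - i - r) <= d)%N by lia.
  have Ei : (d - r - (d - i - r) = i)%N by lia.
  have := tz_th b hr hpq; rewrite Ei => ->.
  rewrite mcoeffZ coef_relr; case: ifP => h; last by rewrite !mulr0 scale0r.
  have Ed : (d - p - q = i + (r + (d - i - r) - (p + q)))%N.
    by move: h; rewrite /hit; case: (b) => /andP[/eqP]; lia.
  rewrite -mul_polyC polyCM polyC_natr Ed exprD.
  by move: (_ - (p + q))%N => D; ring.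
rewrite big1 // => i _; rewrite big1 // => r _.
have ir : (i + r <= d)%N by have := ltn_ord i; have := ltn_ord r; lia.
rewrite mcoeffZ coef_relr ifF ?mulr0 //; apply/negbTE.
move/negbT: hpq; apply: contra; rewrite /hit; case: (b) => /andP[/eqP]; lia.
Qed.

Lemma hom_D F G : hom (fun j k => F j k + G j k) = hom F + hom G.
Proof.
rewrite /hom -big_split; apply: eq_bigr => j _; rewrite -big_split.
by apply: eq_bigr => k _; rewrite /= polyCD mulrDl scalerDl.
Qed.

Lemma eq_hom F G : vec d F = vec d G -> hom F = hom G.
Proof.
move=> E; apply: eq_bigr => j _; apply: eq_bigr => k _.
by rewrite -!submxrow_vec E.
Qed.

(** The projection onto grading 2d. It is a left inverse of [hom] and applies to combinations of
    relations with inhomogeneous coefficients. *)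
Let PI (f : free_ku) := vec d (fun j k => (f@_(k, (d - j - k)%N))`_j).

Lemma PI_hom F : PI (hom F) = vec d F.
Proof.
apply: eq_vec => j k jk; rewrite coef_gen_comb.
have -> : (k + (d - j - k) <= d)%N by lia.
have -> : (d - k - (d - j - k) = j)%N by lia.
by rewrite coefZ coefXn eqxx mulr1.
Qed.

Lemma Sp0 : Sp 0.
Proof. by exists 0, 0; rewrite !mul0mx addr0. Qed.

Lemma SpD c c' : Sp c -> Sp c' -> Sp (c + c').
Proof.
by move=> [a [b ->]] [a' [b' ->]]; exists (a + a'), (b + b'); rewrite !mulmxDl addrACA.
Qed.

Lemma PI_D f g : PI (f + g) = PI f + PI g.
Proof. by rewrite /PI vecD; apply: eq_vec => j k _; rewrite mcoeffD coefD. Qed.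

(** Only the coefficient of u^(d-i-j) in a reaches grading 2d, and none does if i + j > d; what
    results is a multiple of one row. *)
Lemma PI_relr b a i j : Sp (PI (a *: relr b i j)).
Proof.
have EPI : PI (a *: relr b i j) = vec d (fun jj k =>
    if hit b i j k (d - jj - k)%N then
      (a * ('C(n, (i + j - (k + (d - jj - k))).+1)%:R
            * 'X^(i + j - (k + (d - jj - k)))%N))`_jj
    else 0).
  apply: eq_vec => jj k h; rewrite mcoeffZ coef_relr.
  by case: ifP => _ //; rewrite mulr0 coef0.
have [hij|hij] := leqP (i + j) d; last first.
  rewrite EPI (_ : vec _ _ = 0); first exact: Sp0.
  rewrite -[RHS](@mxrow0 _ _ _ _); apply: eq_mxrow => jj; apply/rowP=> k; rewrite !mxE.
  have h : (jj + k <= d)%N by have := ltn_ord jj; have := ltn_ord k; lia.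
  case: ifP => // _; rewrite mulrA coefMXn ifT //; lia.
set i0 := (d - i - j)%N.
have ES : PI (a *: relr b i j) = vec d (emb i0 (fun r => if r == i then a`_i0 else 0)) *m Phi b.
  rewrite EPI vec_Tm; apply: eq_vec => jj k h.
  have i0d : (i0 < d.+1)%N by rewrite /i0; lia.
  have ir : (i < d.+1 - i0)%N by rewrite /i0; lia.
  rewrite (bigD1 (Ordinal i0d)) //= [X in _ = _ + X]big1 ?addr0 => [|i1]; last first.
    by rewrite -val_eqE /= /emb => /negbTE ne; rewrite big1 // => r _; rewrite ne mul0r.
  rewrite (bigD1 (Ordinal ir)) //= [X in _ = _ + X]big1 ?addr0 => [|r]; last first.
    by rewrite -val_eqE /= /emb eqxx => /negbTE ne; rewrite ne mul0r.
  rewrite /emb !eqxx.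
  have hq : (k + (d - jj - k) <= d)%N by lia.
  have Ej : (d - k - (d - jj - k) = jj)%N by lia.
  have := tz_th b hij hq; rewrite Ej -/i0 => ->; case: ifP => hh; last by rewrite mulr0.
  rewrite mulrCA mulr_natl coefMn mulr_natr coefMXn ltnNge.
  have le : (i + j - (k + (d - jj - k)) <= jj)%N by lia.
  rewrite le /=; congr (a`_ _ *+ _).
  by move: hh; rewrite /i0 /hit; case: (b) => /andP[/eqP]; lia.
rewrite ES; case: (b); [exists 0 | exists (vec d (emb i0 (fun r => if r == i then a`_i0 else 0)))].
  by eexists; rewrite mul0mx add0r.
by exists 0; rewrite mul0mx addr0.
Qed.

Lemma relation_span (c : 'rV[Z2loc]_(\sum_(j < d.+1) (d.+1 - j))) :
  relation e c <-> exists a b, c = a *m Phi false + b *m Phi true.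
Proof.
have [F ->] := vecP c; rewrite relation_hom; split=> [/asboolP[s1 [s2 E]]|[a [b]]].
  rewrite -PI_hom E PI_D; apply: SpD.
    elim: s1 {E} => [|x s IH].
      rewrite /ku_comb big_nil (_ : PI 0 = 0); first exact: Sp0.
      by apply: (addIr (PI 0)); rewrite -PI_D !add0r.
    by rewrite /ku_comb big_cons PI_D; apply: SpD IH; apply: (PI_relr true).
  elim: s2 {E} => [|x s IH].
    rewrite /ku_comb big_nil (_ : PI 0 = 0); first exact: Sp0.
    by apply: (addIr (PI 0)); rewrite -PI_D !add0r.
  by rewrite /ku_comb big_cons PI_D; apply: SpD IH; apply: (PI_relr false).
have [A ->] := vecP a; have [B ->] := vecP b => E.
have [f hf [F0 EF Ef]] := hom_Phi false A; have [g hg [G0 EG Eg]] := hom_Phi true B.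
rewrite EF EG vecD in E; rewrite (eq_hom E) hom_D Ef Eg.
exact: rpredD.
Qed.

End Relations.

Theorem theorem2p6 (e : nat) (he : (1 <= e)%N) :
  exists (q : nat -> nat -> {poly Z2loc})
         (P : 'M[{poly Z2loc}]_((2 ^ e.+1 - 3).+1)),
    reduced_form e q P /\ poly_presentation e P.
Proof.
case: e he => [//|e' _]; set e := e'.+1.
have [q [V [hq pV V0 VP]]] := reduction e'; rewrite -/e in hq pV VP.
have NK : (2 ^ e.+1 - 3).+1 = K e.
  have e4 : (4 <= 2 ^ e.+1)%N by rewrite -[4%N]/(2 ^ 2)%N leq_exp2l.
  by rewrite /K; lia.
have ltK (i : 'I_(2 ^ e.+1 - 3).+1) : (i < K e)%N by rewrite -NK.
exists q, (\matrix_(i, j) Pmat e q i j); split=> [i j|d c].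
  rewrite mxE; split=> [v|]; first exact: Pmat_specified.
  exact: Pmat_unspecified.
have dK := ltK d.
have -> : restr_mx (\matrix_(i, j) Pmat e q i j) d = Tm d (Pmat e q).
  by apply: eq_mxblock => i j; rewrite mxE.
have low j : (j <= d)%N -> (j < K e)%N by move=> jd; apply: leq_ltn_trans jd dK.
have Eth b i j : (i <= d)%N -> (j <= d)%N ->
    th (binomial (2 ^ e)) b i j = \sum_(k < d.+1) V b i k * Pmat e q k j.
  move=> id jd; rewrite -VP ?low //.
  apply: (@sum_ord_cut _ d.+1 _ (fun k => V b i k * Pmat e q k j)) => // k /andP[dk _].
  by rewrite /Pmat base_lower ?mul0rn ?mulr0 // (leq_ltn_trans jd).
have EPhi b : Tm d (th (binomial (2 ^ e)) b) = Tm d (V b) *m Tm d (Pmat e q).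
  rewrite TmM => [|k j _ jk|k j jd].
  - by apply: eq_mxblock => i j; rewrite Eth // -ltnS ltn_ord.
  - by rewrite /Pmat base_lower // mul0rn.
  by rewrite /Pmat size_mulrn_exp2; apply: size_base hq _; apply: low.
rewrite relation_span; split=> [[a [b ->]]|[a ->]].
  by exists (a *m Tm d (V false) + b *m Tm d (V true)); rewrite !EPhi !mulmxA -mulmxDl.
(* Writing the identity as A V_false + B V_true turns any combination of rows of P into one of rows
   of the two matrices V_b P, which are the relations. *)
have [A [B EAB]] := pivotal_gen dK pV.
exists (a *m A), (a *m B); rewrite !EPhi -[a in LHS]mulmx1 -EAB.
by rewrite mulmxDr mulmxDl !mulmxA.
Qed.
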